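(* Let $X$ be a trinomial hypersurface which either is of type $H_5$, or is of type $H_2$ and not of type $H_4$. Then all regular points of $X$ form one $\mathrm{Aut}_{alg}(X)$-orbit, and the $\mathrm{Aut}_{alg}(X)$-orbits consisting of singular points are $\mathbb{T}$-orbits.
   Context: $\mathbb{K}$ is an algebraically closed field of characteristic zero. Fix $n=n_0+n_1+n_2$ with $n_0\ge 0$ and $n_1,n_2\ge 1$ integers, and let $T_{ij}$ ($i\in\{0,1,2\}$, $1\le j\le n_i$) be the coordinates on $\mathbb{K}^n$. A trinomial hypersurface is a subvariety $X\subset\mathbb{K}^n$ given by the equation $T_0^{l_0}+T_1^{l_1}+T_2^{l_2}=0$, where $T_i^{l_i}=T_{i1}^{l_{i1}}T_{i2}^{l_{i2}}\cdots T_{in_i}^{l_{in_i}}$ and all $l_{ij}$ are positive integers (if $n_0=0$, then $T_0^{l_0}$ means $1$). The following types of trinomial hypersurfaces are considered up to renumbering the three monomials and the variables within each monomial; here $n_0,n_1,n_2\ge 1$ and the $m_{ij}$ are positive integers. Type $H_2$: $T_{01}^2T_{02}^2\cdots T_{0n_0}^2+T_{11}^2T_{12}^2\cdots T_{1n_1}^2+T_2^{l_2}=0$. Type $H_4$: $T_{01}T_{02}^{l_{02}}\cdots T_{0n_0}^{l_{0n_0}}+T_{11}^2T_{12}^{2m_{12}}\cdots T_{1n_1}^{2m_{1n_1}}+T_{21}^2T_{22}^{2m_{22}}\cdots T_{2n_2}^{2m_{2n_2}}=0$. Type $H_5$: $T_{01}^2T_{02}^{2m_{02}}\cdots T_{0n_0}^{2m_{0n_0}}+T_{11}^2T_{12}^{2m_{12}}\cdots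 T_{1n_1}^{2m_{1n_1}}+T_{21}^2T_{22}^{2m_{22}}\cdots T_{2n_2}^{2m_{2n_2}}=0$. $\mathrm{Aut}_{alg}(X)$ is the subgroup of the group $\mathrm{Aut}(X)$ of regular automorphisms generated by all connected algebraic subgroups of $\mathrm{Aut}(X)$. The torus $(\mathbb{K}^\times)^n$ acts on $\mathbb{K}[T_{ij}]$ by multiplying each $T_{ij}$ by $t_{ij}$; $\mathbb{H}$ is the subgroup stabilizing the line spanned by $T_0^{l_0}+T_1^{l_1}+T_2^{l_2}$, and $\mathbb{T}$ is the neutral (identity) component of $\mathbb{H}$, a torus acting on $X$. *)

(* Defs.v *)
From HB Require Import structures.
From mathcomp Require Import all_boot all_order all_fingroup all_algebra.
From mathcomp.multinomials Require Import mpoly.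

Set Implicit Arguments.
Unset Strict Implicit.
Unset Printing Implicit Defensive.

Import GRing.Theory.
Local Open Scope ring_scope.

(* Points of the affine space K^n are row vectors; the i-th coordinate function
   is the indeterminate 'X_i of {mpoly K[n]}. *)
Section AffineVarieties.

Variable K : fieldType.

Definition peval n (p : {mpoly K[n]}) (x : 'rV[K]_n) : K :=
  p.@[fun i => x 0 i].

(* Zariski-closed subsets; finitely many equations suffice by Hilbert's basis
   theorem. *)
Definition zeros n (ps : seq {mpoly K[n]}) : {pred 'rV[K]_n} :=
  [pred x | all (fun p => peval p x == 0) ps].

(* Connectedness of a subset of K^n for the topology induced by the Zariski
   topology. *)
Definition zconnected n (S : 'rV[K]_n -> Prop) : Prop :=
  (exists x, S x) /\
  forall ps qs : seq {mpoly K[n]},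
    (forall x, S x -> x \in zeros ps \/ x \in zeros qs) ->
    (forall x, S x -> ~ (x \in zeros ps /\ x \in zeros qs)) ->
    (forall x, S x -> x \in zeros ps) \/ (forall x, S x -> x \in zeros qs).

Definition pts n (X : {pred 'rV[K]_n}) : Type := {x : 'rV[K]_n | x \in X}.

Definition pmap n m (F : 'I_m -> {mpoly K[n]}) (x : 'rV[K]_n) : 'rV[K]_m :=
  \row_j peval (F j) x.

Definition morphism n m (X : {pred 'rV[K]_n}) (Y : {pred 'rV[K]_m})
    (f : pts X -> pts Y) : Prop :=
  exists F : 'I_m -> {mpoly K[n]}, forall x, val (f x) = pmap F (val x).

(* Morphisms X * Y -> Z, where X * Y is embedded in K^(n + m). *)
Definition morphism2 n m k (X : {pred 'rV[K]_n}) (Y : {pred 'rV[K]_m})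
    (Z : {pred 'rV[K]_k}) (f : pts X -> pts Y -> pts Z) : Prop :=
  exists F : 'I_k -> {mpoly K[n + m]},
    forall x y, val (f x y) = pmap F (row_mx (val x) (val y)).

Definition is_aut n (X : {pred 'rV[K]_n}) (f : pts X -> pts X) : Prop :=
  morphism f /\ exists g, [/\ morphism g, cancel f g & cancel g f].

Definition aut_subgroup n (X : {pred 'rV[K]_n})
    (G : (pts X -> pts X) -> Prop) : Prop :=
  [/\ forall f, G f -> is_aut f,
      G id,
      forall f g, G f -> G g -> G (f \o g) &
      forall f g, G f -> cancel f g -> cancel g f -> G g].

(* A subgroup G of Aut(X) is a connected algebraic subgroup if it carries the
   structure of a connected algebraic group (here: on the closed subset
   zeros ps of K^m, through the bijection rho) acting regularly on X.  Affine
   groups are enough, since an algebraic group acting faithfully on an affine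
   variety is affine. *)
Definition connected_algebraic_subgroup n (X : {pred 'rV[K]_n})
    (G : (pts X -> pts X) -> Prop) : Prop :=
  aut_subgroup G /\
  exists (m : nat) (ps : seq {mpoly K[m]})
         (rho : pts (zeros ps) -> pts X -> pts X)
         (mul : pts (zeros ps) -> pts (zeros ps) -> pts (zeros ps))
         (inv : pts (zeros ps) -> pts (zeros ps)),
    [/\ zconnected (fun s => s \in zeros ps),
        (forall f, G f <-> exists s, rho s =1 f) /\
        (forall s t, rho s =1 rho t -> s = t),
        morphism2 mul /\ (forall s t, rho (mul s t) =1 rho s \o rho t),
        morphism inv /\ (forall s, cancel (rho s) (rho (inv s))) &
        morphism2 rho].

Definition Aut_alg n (X : {pred 'rV[K]_n}) (f : pts X -> pts X) : Prop :=
  forall H : (pts X -> pts X) -> Prop,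
    aut_subgroup H ->
    (forall G, connected_algebraic_subgroup G -> forall g, G g -> H g) ->
    H f.

Definition is_orbit n (X : {pred 'rV[K]_n}) (G : (pts X -> pts X) -> Prop)
    (O : pts X -> Prop) : Prop :=
  exists x, forall y, O y <-> exists2 f, G f & f x = y.

(* The Zariski tangent space of X at x, defined by the differentials at x of
   all the polynomials vanishing on X. *)
Definition tangent n (X : {pred 'rV[K]_n}) (x v : 'rV[K]_n) : Prop :=
  forall p : {mpoly K[n]}, (forall y, y \in X -> peval p y = 0) ->
    \sum_(i < n) peval p^`M(i) x * v 0 i = 0.

(* Regularity of a point x of a variety X of pure dimension d: the tangent
   space (the row space of V) has dimension d. *)
Definition regular_point n (d : nat) (X : {pred 'rV[K]_n}) (x : pts X) : Prop :=
  exists V : 'M[K]_n,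
    (forall v : 'rV[K]_n, (v <= V)%MS <-> tangent X (val x) v) /\
    \rank V = d.

End AffineVarieties.

Section TorusAction.

Variables (K : fieldType) (n : nat).

Definition in_torus (t : 'rV[K]_n) : Prop := forall i, t 0 i != 0.

Definition torus_act (t x : 'rV[K]_n) : 'rV[K]_n := \row_i (t 0 i * x 0 i).

Definition torus_act_poly (t : 'rV[K]_n) (p : {mpoly K[n]}) : {mpoly K[n]} :=
  p \mPo [tuple t 0 i *: 'X_i | i < n].

Definition line_stabilizer (p : {mpoly K[n]}) (t : 'rV[K]_n) : Prop :=
  in_torus t /\ exists2 c : K, c != 0 & torus_act_poly t p = c *: p.

(* The connected component of the unit element (const_mx 1). *)
Definition neutral_component (H : 'rV[K]_n -> Prop) (t : 'rV[K]_n) : Prop :=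
  exists C : 'rV[K]_n -> Prop,
    [/\ forall s, C s -> H s, zconnected C, C (const_mx 1) & C t].

Definition torus_maps (T : 'rV[K]_n -> Prop) (X : {pred 'rV[K]_n})
    (f : pts X -> pts X) : Prop :=
  exists2 t, T t & forall x, val (f x) = torus_act t (val x).

End TorusAction.

Section Trinomials.

(* The coordinate T_ij is 'X_(tagnat.Rank i j), and l_ij is tnth (l i) j; both
   indices start from 0, so T_ij here is T_i(j+1) in the usual numbering. *)
Variables (K : fieldType) (n : 'I_3 -> nat) (l : forall i, (n i).-tuple nat).

Definition trinomial : {mpoly K[(\sum_i n i)%N]} :=
  \sum_(i < 3) \prod_(j < n i) 'X_(tagnat.Rank i j) ^+ tnth (l i) j.

Definition trinomial_hypersurface : {pred 'rV[K]_(\sum_i n i)%N} :=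
  zeros [:: trinomial].

Definition trinomial_torus : 'rV[K]_(\sum_i n i)%N -> Prop :=
  neutral_component (line_stabilizer trinomial).

End Trinomials.

Section Types.

(* The i-th monomial is represented by the sequence of its exponents. *)
Implicit Types l : 'I_3 -> seq nat.

Definition renumbering l l' : Prop :=
  exists s : 'S_3, forall i, perm_eq (l (s i)) (l' i).

(* Exponents (2, 2 m_2, ..., 2 m_k) with k >= 1 and all m_j positive. *)
Definition two_evens (e : seq nat) : Prop :=
  exists2 m : seq nat, all (ltn 0) m & e = 2%N :: [seq (2 * x)%N | x <- m].

Definition type_H2 l : Prop :=
  exists2 l', renumbering l l' &
    [/\ exists k, l' 0 = nseq k.+1 2%N,
        exists k, l' 1 = nseq k.+1 2%N &
        (0 < size (l' 2%R))%N].

Definition type_H4 l : Prop :=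
  exists2 l', renumbering l l' &
    [/\ exists e, l' 0 = 1%N :: e, two_evens (l' 1) & two_evens (l' 2)].

Definition type_H5 l : Prop :=
  exists2 l', renumbering l l' & forall i, two_evens (l' i).

End Types.

(* Main.v *)
Require Import Defs.
From HB Require Import structures.
From mathcomp Require Import all_boot all_order all_fingroup all_algebra.
From mathcomp.multinomials Require Import mpoly.
From mathcomp Require Import cyclotomic separable ring.
From Stdlib Require Import Classical.

Set Implicit Arguments.
Unset Strict Implicit.
Unset Printing Implicit Defensive.

Import GRing.Theory.
Local Open Scope ring_scope.

(** Write the equation of X as M_0 + M_1 + M_2 = 0. In type H_5, and in type H_2
    outside type H_4, all exponents are at least 2; hence a point of X is
    singular exactly when the three monomials vanish at it (regularP). The
    tangent spaces are defined by all polynomials vanishing on X, and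
    vanishing_divisible shows that, up to factors that are harmless at the point
    considered, these polynomials are multiples of the equation.

    Regular points. Two of the monomials are squares and contain variables x_a
    and x_b with exponent 2. If x_c is a variable of the third one, the equation
    becomes (A x_a)^2 + (B x_b)^2 + C x_c^d = 0, that is u v + C x_c^d = 0 with
    u = A x_a + i B x_b and v = A x_a - i B x_b. A locally nilpotent derivation
    with kernel containing u, A, B and C has a flow, an action of the additive
    group, which moves x_c freely as long as u A B is nonzero. Exchanging i and -i
    gives a flow that fixes v. Rescaling two variables of the same monomial in
    opposite ways is an action of the multiplicative group. With these three
    moves every point at which u or v is nonzero, as well as all variables of the
    first two monomials other than x_a and x_b, is brought to a standard point
    (units_base_point). At a regular point at most one monomial vanishes. In type
    H_5 that monomial can be taken for the third one. In type H_2 it may also be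
    one of the two squares; then the flow at A = 0 moves x_a alone, and makes the
    vanishing variables nonzero until at most one is left, which is taken as x_a
    (transitive_square_blocks).

    Singular points. The singular locus is the union of the coordinate subspaces
    defined by the vanishing of one variable of each monomial. Automorphisms
    permute these components, and a connected group cannot permute them
    nontrivially (connected_generic). The vanishing coordinates of a singular
    point are determined by the components that contain it, hence they are
    invariant under Aut_alg(X). Conversely, at a singular point each
    monomial has a vanishing coordinate, which compensates for arbitrary
    rescalings of the nonvanishing ones; hence two singular points with the same
    vanishing coordinates are connected by one-parameter subtori
    (same_zeros_same_orbit), as well as by an element that a rational curve joins
    to 1 in the stabilizer of the equation (same_zeros_torus). So the
    Aut_alg(X)-orbit and the torus orbit of a singular point are both the set of
    points with the same vanishing coordinates. *)

(** * Polynomials in several variables over an infinite field *)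

Section PolynomialRing.

Variable K : fieldType.

Lemma mpoly_ring_ind n (P : {mpoly K[n]} -> Prop) :
  (forall c, P c%:MP) -> (forall i, P 'X_i) ->
  (forall p q, P p -> P q -> P (p + q)) ->
  (forall p q, P p -> P q -> P (p * q)) -> forall p, P p.
Proof.
move=> PC PX PD PM p; elim/mpolyind: p => [|c m p _ _ Pp]; first exact: PC 0.
apply: (PD _ _ _ Pp); rewrite -mul_mpolyC; apply: (PM _ _ (PC c)).
rewrite mpolyXE_id; apply: (big_ind P) => [||i _]; [exact: PC 1 | exact: PM |].
elim: (m i) => [|k IHk]; first by rewrite expr0; exact: PC 1.
by rewrite exprS; apply: PM.
Qed.

Lemma mpoly_rmorph_eq n (S : nzRingType) (f g : {rmorphism {mpoly K[n]} -> S}) :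
  (forall c, f c%:MP = g c%:MP) -> (forall i, f 'X_i = g 'X_i) -> f =1 g.
Proof.
move=> fgC fgX; elim/mpoly_ring_ind => // p q IHp IHq.
  by rewrite !rmorphD IHp IHq.
by rewrite !rmorphM IHp IHq.
Qed.

Lemma pevalD n (p q : {mpoly K[n]}) x : peval (p + q) x = peval p x + peval q x.
Proof. exact: mevalD. Qed.

Lemma pevalM n (p q : {mpoly K[n]}) x : peval (p * q) x = peval p x * peval q x.
Proof. exact: mevalM. Qed.

Lemma pevalC n c x : peval (c%:MP : {mpoly K[n]}) x = c.
Proof. exact: mevalC. Qed.

Lemma pevalX n i x : peval ('X_i : {mpoly K[n]}) x = x 0 i.
Proof. exact: mevalXU. Qed.

Definition upd n (x : 'rV[K]_n) (j : 'I_n) (t : K) : 'rV[K]_n :=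
  \row_k (if k == j then t else x 0 k).

Lemma updE n (x : 'rV[K]_n) j t k :
  upd x j t 0 k = if k == j then t else x 0 k.
Proof. by rewrite mxE. Qed.

(** A polynomial seen as a univariate polynomial in its j-th variable. The
    coefficients are kept in the same ring in n variables, of which they do not
    use the j-th one, so that they can be compared with the given polynomials.
    *)
Definition uni n (j : 'I_n) (p : {mpoly K[n]}) : {poly {mpoly K[n]}} :=
  mmap (polyC \o @mpolyC n K) (fun k => if k == j then 'X else ('X_k)%:P) p.

HB.instance Definition _ n (j : 'I_n) := GRing.RMorphism.copy (uni j)
  (mmap (polyC \o @mpolyC n K) (fun k => if k == j then 'X else ('X_k)%:P)).

Lemma uniC n (j : 'I_n) c : uni j c%:MP = c%:MP%:P.
Proof. by rewrite /uni mmapC. Qed.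

Lemma uniX n (j k : 'I_n) : uni j 'X_k = if k == j then 'X else ('X_k)%:P.
Proof. by rewrite /uni mmapX mmap1U. Qed.

Lemma uniD n (j : 'I_n) p q : uni j (p + q) = uni j p + uni j q.
Proof. exact: rmorphD. Qed.

Lemma uniM n (j : 'I_n) p q : uni j (p * q) = uni j p * uni j q.
Proof. exact: rmorphM. Qed.

Lemma uni_peval n (j : 'I_n) p (x : 'rV[K]_n) t :
  (map_poly (meval (fun i => x 0 i)) (uni j p)).[t] = peval p (upd x j t).
Proof.
move: p; apply: (@mpoly_rmorph_eq n K
  (horner_eval t \o map_poly (meval (fun i => x 0 i)) \o uni j)
  (meval (fun i => upd x j t 0 i))) => [c|i] /=.
  by rewrite uniC map_polyC /horner_eval hornerC /= mevalC [RHS]mevalC.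
rewrite uniX mevalXU updE; case: eqP => _.
  by rewrite map_polyX /horner_eval hornerX.
by rewrite map_polyC /horner_eval hornerC /= mevalXU.
Qed.

Lemma uni_horner n (j : 'I_n) p : (uni j p).['X_j] = p.
Proof.
move: p; apply: (@mpoly_rmorph_eq n _ (horner_eval 'X_j \o uni j) idfun) => [c|i] /=.
  by rewrite uniC /horner_eval hornerC.
rewrite uniX /horner_eval; case: eqP => [->|_]; first by rewrite hornerX.
by rewrite hornerC.
Qed.

End PolynomialRing.

Section Infinite.
Variable (K : fieldType).
Hypothesis charK0 : [pchar K] =i pred0.

Lemma natr_inj : injective (fun m : nat => m%:R : K).
Proof.
have H m k : (m <= k)%N -> m%:R = k%:R :> K -> m = k.
  move=> lemk /eqP; rewrite eq_sym -subr_eq0 -natrB // .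
  rewrite ((pcharf0P K).1 charK0) subn_eq0 => lekm.
  by apply/eqP; rewrite eqn_leq lemk.
move=> m k; case/orP: (leq_total m k) => [/H //|/H h /esym/h //].
Qed.

(** The images of the natural numbers are infinitely many roots. *)
Lemma poly_eq0_vanish (R : idomainType) (f : {rmorphism K -> R}) (p : {poly R}) :
  (forall c, p.[f c] = 0) -> p = 0.
Proof.
move=> p0; pose rs : seq R := [seq f (i%:R) | i <- iota 0 (size p)].
apply: (@roots_geq_poly_eq0 _ p rs); last by rewrite size_map size_iota.
  by apply/allP=> _ /mapP[i _ ->]; rewrite rootE p0.
rewrite map_inj_uniq ?iota_uniq //; move=> a b /fmorph_inj; exact: natr_inj.
Qed.

(** The variables are specialized one at a time, each specialization being an
    instance of the univariate case over a polynomial ring. *)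
Lemma peval_eq0 n (p : {mpoly K[n]}) : (forall x, peval p x = 0) -> p = 0.
Proof.
pose h (s : seq 'I_n) (x : 'rV[K]_n) (k : 'I_n) : {mpoly K[n]} :=
  if k \in s then (x 0 k)%:MP else 'X_k.
suff H (s : seq 'I_n) : (forall x, mmap (@mpolyC n K) (h s x) p = 0) -> p = 0.
  move=> p0; apply: (H (enum 'I_n)) => x; rewrite -[RHS](mpolyC0 n) -(p0 x) /peval.
  move: p {H p0}; apply: (@mpoly_rmorph_eq _ n _ (mmap (@mpolyC n K) (h (enum 'I_n) x))
     (@mpolyC n K \o (meval (fun i => x 0 i)))) => [c|i] /=.
    by rewrite mmapC mevalC.
  by rewrite mmapX mmap1U mevalXU /h mem_enum.
elim: s => [|j s IHs] p0.
  rewrite -[RHS](p0 0); symmetry; apply: (@mpoly_rmorph_eq _ n _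
    (mmap (@mpolyC n K) (h [::] 0)) idfun) => [c|i] /=; first by rewrite mmapC.
  by rewrite mmapX mmap1U.
apply: IHs => x; set q := mmap _ _ p.
rewrite -[q](uni_horner j); set u := uni j q.
suff ->: u = 0 by rewrite horner0.
apply: (@poly_eq0_vanish _ (@mpolyC n K)) => c.
rewrite -(p0 (\row_k if k \in s then x 0 k else c)) /u /q.
move: p {p0 q u}; apply: (@mpoly_rmorph_eq _ n _
  (horner_eval c%:MP \o uni j \o mmap (@mpolyC n K) (h s x))
  (mmap (@mpolyC n K) (h _ _))) => [b|i] /=.
  by rewrite !mmapC uniC /horner_eval hornerC.
rewrite !mmapX !mmap1U /h inE mxE; case: (boolP (i \in s)) => si.
  by rewrite orbT uniC /horner_eval hornerC.
rewrite orbF uniX /horner_eval; case: eqP => _; by rewrite ?hornerX ?hornerC.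
Qed.

End Infinite.

(** * Differentials *)

Section Differentials.

Variable K : fieldType.

Definition differential n (p : {mpoly K[n]}) (x v : 'rV[K]_n) : K :=
  \sum_(i < n) peval p^`M(i) x * v 0 i.

Lemma differentialD n (p q : {mpoly K[n]}) x v :
  differential (p + q) x v = differential p x v + differential q x v.
Proof.
rewrite /differential -big_split; apply: eq_bigr => i _.
by rewrite mderivD pevalD mulrDl.
Qed.

Lemma differentialB n (p q : {mpoly K[n]}) x v :
  differential (p - q) x v = differential p x v - differential q x v.
Proof.
rewrite /differential -sumrB; apply: eq_bigr => i _.
by rewrite mderivB /peval mevalB mulrBl.
Qed.

Lemma differentialM n (p q : {mpoly K[n]}) x v :
  differential (p * q) x v =
    differential p x v * peval q x + peval p x * differential q x v.
Proof.
rewrite /differential mulr_suml mulr_sumr -big_split; apply: eq_bigr => i _ /=.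
by rewrite mderivM pevalD !pevalM mulrDl mulrAC mulrA.
Qed.

Lemma differentialC n c (x v : 'rV[K]_n) : differential c%:MP x v = 0.
Proof.
by rewrite /differential big1 // => i _; rewrite mderivC -(mpolyC0 n K) pevalC mul0r.
Qed.

Lemma mderivXU n (i k : 'I_n) : ('X_k : {mpoly K[n]})^`M(i) = (k == i)%:R.
Proof.
rewrite mderivX mnm1E; case: eqP => [->|_]; last by rewrite scale0r.
by rewrite scale1r -{1}[U_(i)%MM]add0m addmK mpolyX0.
Qed.

Lemma differentialX n k (x v : 'rV[K]_n) : differential 'X_k x v = v 0 k.
Proof.
rewrite /differential (bigD1 k) //= big1 => [|i ik].
  by rewrite mderivXU eqxx addr0 mulr1n -mpolyC1 pevalC mul1r.
by rewrite mderivXU eq_sym (negPf ik) mulr0n -(mpolyC0 n K) pevalC mul0r.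
Qed.

Definition mpoly_subst n m (p : {mpoly K[m]}) (F : 'I_m -> {mpoly K[n]}) :=
  p \mPo [tuple F j | j < m].

Lemma peval_comp n m (p : {mpoly K[m]}) (F : 'I_m -> {mpoly K[n]}) x :
  peval (mpoly_subst p F) x = peval p (Defs.pmap F x).
Proof.
rewrite /peval /mpoly_subst comp_mpoly_meval; apply: meval_eq => j.
by rewrite tnth_mktuple mxE.
Qed.

Lemma differential_comp n m (p : {mpoly K[m]}) (F : 'I_m -> {mpoly K[n]}) x v :
  differential (mpoly_subst p F) x v
  = differential p (Defs.pmap F x) (\row_j differential (F j) x v).
Proof.
rewrite /mpoly_subst; elim/mpoly_ring_ind: p => [c|i|p q IHp IHq|p q IHp IHq].
- by rewrite comp_mpolyC !differentialC.
- by rewrite comp_mpolyXU differentialX mxE -tnth_nth tnth_mktuple.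
- by rewrite comp_mpolyD !differentialD IHp IHq.
rewrite rmorphM /= !differentialM IHp IHq.
by rewrite -!/(mpoly_subst _ F) !peval_comp.
Qed.

(** Both sides are derivations that agree on the variables. *)
Lemma mderiv_uni n (j : 'I_n) (p : {mpoly K[n]}) :
  p^`M(j) = ((uni j p)^`()).['X_j].
Proof.
elim/mpoly_ring_ind: p => [c|k|p q IHp IHq|p q IHp IHq].
- by rewrite uniC derivC horner0 mderivC.
- rewrite uniX mderivXU; case: eqP => _; first by rewrite derivX hornerC.
  by rewrite derivC horner0.
- by rewrite mderivD uniD derivD hornerD IHp IHq.
rewrite mderivM uniM derivM; move: (uni_horner j p) (uni_horner j q) IHp IHq.
move: (uni j p) (uni j q) => P Q Pp Qq -> ->.
by rewrite hornerD !hornerM Pp Qq.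
Qed.

Lemma peval_mderiv n (j : 'I_n) (p : {mpoly K[n]}) x :
  peval p^`M(j) x
  = (map_poly (meval (fun i => x 0 i)) (uni j p))^`().[x 0 j].
Proof.
rewrite mderiv_uni deriv_map /peval -[in RHS](@mevalXU n K (fun i => x 0 i) j).
by rewrite horner_map.
Qed.

End Differentials.

(** * Polynomials vanishing on a hypersurface *)

Section Division.

Variable K : closedFieldType.
Hypothesis charK0 : [pchar K] =i pred0.

Lemma exists_root (d : nat) (c : K) : (0 < d)%N -> exists t, t ^+ d = c.
Proof.
move=> d_gt0; have [t tE] := solve_monicpoly (fun i => if i == 0%N then c else 0) d_gt0.
exists t; rewrite tE (bigD1 (Ordinal d_gt0)) //= expr0 mulr1 big1 ?addr0 //.
move=> i ni; rewrite -val_eqE in ni.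
by rewrite (negPf ni) mul0r.
Qed.

(** They are the multiples of one root by the d-th roots of unity, which are
    distinct in characteristic zero. *)
Lemma distinct_roots (d : nat) (a b : K) : (0 < d)%N -> a != 0 -> b != 0 ->
  exists rs, [/\ size rs = d, uniq rs & forall t, t \in rs -> a * t ^+ d + b = 0].
Proof.
move=> d_gt0 a0 b0; have [t0 t0E] := exists_root (- b / a) d_gt0.
have t00 : t0 != 0.
  apply/eqP => t00; move/eqP: t0E.
  by rewrite t00 expr0n gtn_eqF // eq_sym mulf_eq0 invr_eq0 oppr_eq0 (negPf a0) (negPf b0).
have [rs rsE] := closed_field_poly_normal ('X^d - 1 : {poly K}).
have lc : lead_coef ('X^d - 1 : {poly K}) = 1 by rewrite lead_coefXnsubC.
rewrite lc scale1r in rsE.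
have urs : uniq rs.
  rewrite -separable_prod_XsubC -rsE cyclotomic.separable_Xn_sub_1 //.
  by rewrite ((pcharf0P K).1 charK0) -lt0n.
exists [seq t0 * t | t <- rs]; split.
- have := congr1 (fun p : {poly K} => size p) rsE.
  by rewrite size_XnsubC // size_prod_XsubC size_map => -[].
- by rewrite map_inj_uniq //; apply: mulfI.
move=> _ /mapP[t trs ->]; have : root ('X^d - 1) t by rewrite rsE root_prod_XsubC.
rewrite rootE !hornerE subr_eq0 => /eqP tE.
by rewrite exprMn t0E tE mulr1 mulrC divfK // addNr.
Qed.

Definition vanishes_on n (X : {pred 'rV[K]_n}) (p : {mpoly K[n]}) :=
  forall y, y \in X -> peval p y = 0.

(** Over a general choice of the variables other than x_j, the polynomial f has
    d distinct roots x_j. The remainder of the pseudo-division of p by f with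
    respect to x_j has degree less than d and vanishes at all of them, hence is
    zero. The power of a is the one of the pseudo-division. *)
Lemma vanishing_divisible n (j : 'I_n) (d : nat) (a b p : {mpoly K[n]}) :
  (0 < d)%N -> a != 0 -> b != 0 -> uni j a = a%:P -> uni j b = b%:P ->
  let f := a * 'X_j ^+ d + b in
  vanishes_on (zeros [:: f]) p ->
  exists k q, a ^+ k * p = q * f.
Proof.
move=> d_gt0 a0 b0 ua ub f pX.
pose F := uni j f.
have FE : F = a%:P * 'X^d + b%:P.
  by rewrite /F /f uniD uniM rmorphXn /= uniX eqxx ua ub.
have szaX : size (a%:P * 'X^d) = d.+1 by rewrite mul_polyC size_scale ?size_polyXn.
have szb : (size (b%:P : {poly {mpoly K[n]}}) < d.+1)%N.
  by rewrite ltnS (leq_trans (size_polyC_leq1 _)).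
have szF : size F = d.+1 by rewrite FE size_polyDl ?szaX.
have lcF : lead_coef F = a.
  by rewrite FE lead_coefDl ?szaX // mul_polyC lead_coefZ lead_coefXn mulr1.
have F0 : F != 0 by rewrite -size_poly_eq0 szF.
have divE := Pdiv.Idomain.divp_eq (uni j p) F; rewrite lcF in divE.
set r := (uni j p %% F)%R in divE.
have szr : (size r <= d)%N by rewrite -ltnS -szF Pdiv.Idomain.ltn_modp.
suff r0 : r = 0.
  move: divE (uni_horner j p) (uni_horner j f); rewrite r0 addr0 -/F.
  move: (uni j p) (uni j p %/ F) (Pdiv.Idomain.scalp _ _) => P Q m E Pp Ff.
  exists m, Q.['X_j]; rewrite -{1}Pp -hornerZ E hornerM; congr (_ * _).
  exact: Ff.
apply/polyP => i; rewrite coef0; apply/eqP.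
suff : a * b * r`_i == 0.
  by rewrite !mulf_eq0 (negPf a0) (negPf b0).
apply/eqP/(peval_eq0 charK0) => x; rewrite !pevalM.
have [-> | ax0] := eqVneq (peval a x) 0; first by rewrite !mul0r.
have [-> | bx0] := eqVneq (peval b x) 0; first by rewrite mulr0 !mul0r.
pose ev := map_poly (meval (fun i => x 0 i)).
suff rx0 : ev r = 0.
  have := congr1 (fun P : {poly K} => P`_i) rx0; rewrite coef_map coef0 /peval => ->.
  by rewrite mulr0.
have [rs [szrs urs rsE]] := distinct_roots d_gt0 ax0 bx0.
apply: (@roots_geq_poly_eq0 _ _ rs) => //; last first.
  by rewrite szrs (leq_trans (size_poly _ _)).
apply/allP => t trs; rewrite rootE.
have Ft : (ev F).[t] = 0.
  rewrite /ev FE rmorphD rmorphM /= !map_polyC map_polyXn !hornerE.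
  exact: rsE.
have yX : upd x j t \in zeros [:: f].
  by rewrite inE /= -uni_peval -/F andbT; apply/eqP.
have pt : (ev (uni j p)).[t] = 0 by rewrite /ev uni_peval pX.
have := congr1 (fun P : {poly {mpoly K[n]}} => (ev P).[t]) divE.
rewrite /ev rmorphD rmorphM /= -mul_polyC rmorphM /= hornerM [in X in X = _]/= -/ev pt.
by rewrite mulr0 hornerD hornerM Ft mulr0 add0r => <-.
Qed.

(** Differentiating a^k p = q f at a common zero of p and f leaves a(x)^k dp =
    q(x) df. *)
Lemma differential_divisible n (p : {mpoly K[n]}) (a f : {mpoly K[n]}) x v k q :
  peval a x != 0 -> peval p x = 0 -> peval f x = 0 -> a ^+ k * p = q * f ->
  differential f x v = 0 -> differential p x v = 0.
Proof.
move=> a0 p0 f0 E df0; have := congr1 (fun P => differential P x v) E.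
rewrite !differentialM p0 f0 df0 !mulr0 addr0 add0r => /eqP.
rewrite mulf_eq0 => /orP[|/eqP //]; rewrite /peval rmorphXn /= expf_eq0 => /andP[_].
by move=> /eqP a0'; rewrite /peval a0' eqxx in a0.
Qed.

End Division.

(** * Automorphisms preserve regular points *)

Section RegularAut.
Variable K : fieldType.

(** The differential of an automorphism maps tangent spaces onto tangent
    spaces, with inverse the differential of the inverse automorphism. *)
Lemma is_aut_regular n d (X : {pred 'rV[K]_n}) (f : pts X -> pts X) x :
  is_aut f -> regular_point d x -> regular_point d (f x).
Proof.
case=> -[F FE] [g [[G GE] fK gK]] [V [VT rkV]].
pose J (P : 'I_n -> {mpoly K[n]}) y := \matrix_(i, j) peval (P j)^`M(i) y.
have JE P y v : v *m J P y = \row_j differential (P j) y v.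
  apply/rowP=> j; rewrite !mxE; apply: eq_bigr => i _.
  by rewrite mxE mulrC.
have push (P : 'I_n -> {mpoly K[n]}) (h : pts X -> pts X) y v :
    (forall z, val (h z) = Defs.pmap P (val z)) ->
    tangent X (val y) v -> tangent X (val (h y)) (v *m J P (val y)).
  move=> hE Tv p pX; rewrite JE hE.
  have := @differential_comp _ _ _ p P (val y) v; rewrite /differential => <-.
  apply: Tv => z zX; rewrite peval_comp.
  have := hE (exist _ z zX) => /= <-; apply: pX; exact: valP.
(* The composite of the two morphisms is the identity on X only, but tangent
   vectors are killed by the differentials of all functions vanishing on X. *)
have pushK (P Q : 'I_n -> {mpoly K[n]}) (h k : pts X -> pts X) y v :
    (forall z, val (h z) = Defs.pmap P (val z)) ->
    (forall z, val (k z) = Defs.pmap Q (val z)) -> cancel h k ->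
    tangent X (val y) v -> v *m J P (val y) *m J Q (val (h y)) = v.
  move=> hE kE hkK Tv; rewrite JE JE; apply/rowP => j; rewrite mxE hE.
  rewrite -differential_comp; apply/eqP; rewrite -subr_eq0.
  have -> : v 0 j = differential 'X_j (val y) v by rewrite differentialX.
  rewrite -differentialB.
  apply/eqP; apply: Tv => z zX; rewrite /peval mevalB -!/(peval _ _).
  rewrite peval_comp pevalX; have := hE (exist _ z zX) => /= <-.
  have := kE (h (exist _ z zX)); rewrite hkK /= => /rowP/(_ j).
  by rewrite mxE => <-; rewrite subrr.
exists (V *m J F (val x)); split; last first.
  apply/eqP; rewrite -rkV eqn_leq mxrankM_maxl /=.
  have {1}<- : V *m J F (val x) *m J G (val (f x)) = V; last exact: mxrankM_maxl.
  apply/row_matrixP => i; rewrite !row_mul.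
  by apply: (pushK F G f g) => //; apply/VT; apply: row_sub.
move=> v; split => [/submxP[w ->]|Tv].
  rewrite mulmxA; apply: push => //; apply/VT; exact: submxMl.
have := pushK G F g f (f x) v GE FE gK Tv; rewrite fK => <-.
apply: submxMr; apply/VT.
by have := push G g (f x) v GE Tv; rewrite fK.
Qed.

End RegularAut.

(** * Polynomial functions and maps *)

Section PolynomialFunctions.
Variable K : fieldType.

(** Polynomial functions are recognized through their values, which dispenses
    with writing down the polynomials that define the actions below. *)
Definition polyfun n (h : 'rV[K]_n -> K) := exists p, forall x, h x = peval p x.

Definition polymap n m (g : 'rV[K]_n -> 'rV[K]_m) :=
  forall j, polyfun (fun x => g x 0 j).

Lemma polyfun_ext n (h k : 'rV[K]_n -> K) : h =1 k -> polyfun h -> polyfun k.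
Proof. by move=> hk [p pE]; exists p => x; rewrite -hk. Qed.

Lemma polyfunC n c : polyfun (fun _ : 'rV[K]_n => c).
Proof. by exists c%:MP => x; rewrite pevalC. Qed.

Lemma polyfunX n j : polyfun (fun x : 'rV[K]_n => x 0 j).
Proof. by exists 'X_j => x; rewrite pevalX. Qed.

Lemma polyfunD n (h k : 'rV[K]_n -> K) :
  polyfun h -> polyfun k -> polyfun (fun x => h x + k x).
Proof. by move=> [p pE] [q qE]; exists (p + q) => x; rewrite pevalD pE qE. Qed.

Lemma polyfunM n (h k : 'rV[K]_n -> K) :
  polyfun h -> polyfun k -> polyfun (fun x => h x * k x).
Proof. by move=> [p pE] [q qE]; exists (p * q) => x; rewrite pevalM pE qE. Qed.

Lemma polyfunN n (h : 'rV[K]_n -> K) : polyfun h -> polyfun (fun x => - h x).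
Proof.
move=> hp; apply: (@polyfun_ext _ (fun x => -1 * h x)) => [x|].
  by rewrite mulN1r.
exact: polyfunM (polyfunC _ _) hp.
Qed.

Lemma polyfun_exp n (h : 'rV[K]_n -> K) m :
  polyfun h -> polyfun (fun x => h x ^+ m).
Proof. by move=> [p pE]; exists (p ^+ m) => x; rewrite pE /peval rmorphXn. Qed.

Lemma polyfun_sum n (I : Type) (r : seq I) (P : pred I) (h : I -> 'rV[K]_n -> K) :
  (forall i, P i -> polyfun (h i)) -> polyfun (fun x => \sum_(i <- r | P i) h i x).
Proof.
move=> hP; elim: r => [|i r IHr].
  by apply: polyfun_ext (polyfunC _ 0) => x; rewrite big_nil.
case Pi: (P i).
  by apply: polyfun_ext (polyfunD (hP i Pi) IHr) => x; rewrite big_cons Pi.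
by apply: polyfun_ext IHr => x; rewrite big_cons Pi.
Qed.

Lemma polyfun_prod n (I : Type) (r : seq I) (P : pred I) (h : I -> 'rV[K]_n -> K) :
  (forall i, P i -> polyfun (h i)) -> polyfun (fun x => \prod_(i <- r | P i) h i x).
Proof.
move=> hP; elim: r => [|i r IHr].
  by apply: polyfun_ext (polyfunC _ 1) => x; rewrite big_nil.
case Pi: (P i).
  by apply: polyfun_ext (polyfunM (hP i Pi) IHr) => x; rewrite big_cons Pi.
by apply: polyfun_ext IHr => x; rewrite big_cons Pi.
Qed.

Lemma polymapP n m (g : 'rV[K]_n -> 'rV[K]_m) : polymap g ->
  exists F, forall x, g x = Defs.pmap F x.
Proof.
move=> /fin_all_exists[F FE]; exists F => x.
by apply/rowP => j; rewrite FE mxE.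
Qed.

Lemma polyfun_comp n m (h : 'rV[K]_m -> K) (g : 'rV[K]_n -> 'rV[K]_m) :
  polyfun h -> polymap g -> polyfun (fun x => h (g x)).
Proof.
move=> [p pE] /polymapP[F FE]; exists (mpoly_subst p F) => x.
by rewrite pE FE peval_comp.
Qed.

Lemma polymap_id n : polymap (@id 'rV[K]_n).
Proof. move=> j; exact: polyfunX. Qed.

Lemma polymap_cst n m (c : 'rV[K]_m) : polymap (fun _ : 'rV[K]_n => c).
Proof. move=> j; exact: polyfunC. Qed.

Lemma polymap_row_mx n m1 m2 (g : 'rV[K]_n -> 'rV[K]_m1) (h : 'rV[K]_n -> 'rV[K]_m2) :
  polymap g -> polymap h -> polymap (fun x => row_mx (g x) (h x)).
Proof.
move=> gP hP j; case: (splitP j) => k jk.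
  have -> : j = lshift m2 k by apply: val_inj.
  by apply: polyfun_ext (gP k) => x; rewrite row_mxEl.
have -> : j = rshift m1 k by apply: val_inj.
by apply: polyfun_ext (hP k) => x; rewrite row_mxEr.
Qed.

Lemma polyfun_lsub n1 n2 j : polyfun (fun w : 'rV[K]_(n1 + n2) => lsubmx w 0 j).
Proof. by apply: polyfun_ext (polyfunX (lshift n2 j)) => w; rewrite mxE. Qed.

Lemma polyfun_rsub n1 n2 j : polyfun (fun w : 'rV[K]_(n1 + n2) => rsubmx w 0 j).
Proof. by apply: polyfun_ext (polyfunX (rshift n1 j)) => w; rewrite mxE. Qed.

End PolynomialFunctions.

(** * Connectedness of rational curves *)

Section Irreducible.
Variable K : fieldType.
Hypothesis charK0 : [pchar K] =i pred0.

(** If two closed sets cover S and neither contains it, pick for each an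
    equation that does not vanish on S: the product of the two vanishes on S.
    *)
Lemma irreducible_zconnected n (S : 'rV[K]_n -> Prop) :
  (exists x, S x) ->
  (forall p q, (forall x, S x -> peval p x = 0 \/ peval q x = 0) ->
     (forall x, S x -> peval p x = 0) \/ (forall x, S x -> peval q x = 0)) ->
  zconnected S.
Proof.
move=> S0 irr; split=> // ps qs cover _.
have vanish (rs : seq {mpoly K[n]}) :
  (forall x, S x -> x \in zeros rs) \/
  exists r, r \in rs /\ ~ forall x, S x -> peval r x = 0.
  case: (classic (exists r, r \in rs /\ ~ forall x, S x -> peval r x = 0)).
    by right.
  move=> H; left=> x Sx; rewrite inE; apply/allP => r rrs; apply/eqP.
  by apply: NNPP => rx; apply: H; exists r; split=> // /(_ x Sx).
case: (vanish ps) => [|[p [pps Hp]]]; first by left.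
case: (vanish qs) => [|[q [qqs Hq]]]; first by right.
case: (irr p q) => // x Sx; case: (cover x Sx); rewrite inE => /allP H.
  by left; apply/eqP/H.
by right; apply/eqP/H.
Qed.

(** The functions P / D^m on the open set where D does not vanish, with values
    left free elsewhere. *)
Definition ratfun (D : {poly K}) (h : K -> K) :=
  exists (P : {poly K}) m, forall t, D.[t] != 0 -> D.[t] ^+ m * h t = P.[t].

Lemma ratfun_poly D (P : {poly K}) : ratfun D (fun t => P.[t]).
Proof. by exists P, 0%N => t _; rewrite mul1r. Qed.

Lemma ratfun_cst D c : ratfun D (fun=> c).
Proof. by exists c%:P, 0%N => t _; rewrite mul1r hornerC. Qed.

Lemma ratfunD D h k : ratfun D h -> ratfun D k -> ratfun D (fun t => h t + k t).
Proof.
move=> [P [m PE]] [Q [l QE]]; exists (D ^+ l * P + D ^+ m * Q), (m + l)%N => t Dt.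
rewrite !hornerE -PE // -QE // mulrDr exprD; congr (_ + _); last by rewrite mulrA.
by rewrite mulrCA mulrA.
Qed.

Lemma ratfunM D h k : ratfun D h -> ratfun D k -> ratfun D (fun t => h t * k t).
Proof.
move=> [P [m PE]] [Q [l QE]]; exists (P * Q), (m + l)%N => t Dt.
by rewrite hornerM -PE // -QE // exprD mulrACA.
Qed.

Lemma ratfun_exp D h m : ratfun D h -> ratfun D (fun t => h t ^+ m).
Proof.
move=> [P [l PE]]; exists (P ^+ m), (l * m)%N => t Dt.
by rewrite !hornerE -PE // exprMn exprM.
Qed.

Lemma ratfun_prod D (I : Type) (r : seq I) (P : pred I) (h : I -> K -> K) :
  (forall i, P i -> ratfun D (h i)) ->
  ratfun D (fun t => \prod_(i <- r | P i) h i t).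
Proof.
move=> hP; elim: r => [|i r [Q [m QE]]].
  by exists 1, 0%N => t _; rewrite big_nil hornerC mulr1.
case Pi: (P i); last by exists Q, m => t Dt; rewrite big_cons Pi QE.
have [R [l RE]] := ratfunM (hP i Pi) (ex_intro _ Q (ex_intro _ m QE)).
by exists R, l => t Dt; rewrite big_cons Pi RE.
Qed.

(** A rational curve is irreducible: after clearing denominators, vanishing on
    it becomes the vanishing of a univariate polynomial. *)
Lemma rational_curve_zconnected n (D : {poly K}) (g : K -> 'rV[K]_n) :
  D != 0 -> (forall i, ratfun D (fun t => g t 0 i)) ->
  zconnected (fun x => exists2 t, D.[t] != 0 & x = g t).
Proof.
move=> D0 gP.
have pg (p : {mpoly K[n]}) : ratfun D (fun t => peval p (g t)).
  elim/mpoly_ring_ind: p => [c|i|p q IHp IHq|p q IHp IHq].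
  - by exists c%:P, 0%N => t _; rewrite pevalC mul1r hornerC.
  - by have [P [m PE]] := gP i; exists P, m => t Dt; rewrite pevalX PE.
  - have [P [m PE]] := ratfunD IHp IHq.
    by exists P, m => t Dt; rewrite pevalD PE.
  - have [P [m PE]] := ratfunM IHp IHq.
    by exists P, m => t Dt; rewrite pevalM PE.
apply: irreducible_zconnected.
  suff [t Dt] : exists t, D.[t] != 0 by exists (g t), t.
  apply: NNPP => H; case/eqP: D0; apply: (@poly_eq0_vanish K charK0 _ idfun) => t /=.
  by apply/eqP/negPn/negP => Dt; apply: H; exists t.
move=> p q pq; have [P [m PE]] := pg p; have [Q [l QE]] := pg q.
have : D * P * Q = 0.
  apply: (@poly_eq0_vanish K charK0 _ idfun) => t /=; rewrite !hornerM.
  have [->|Dt] := eqVneq D.[t] 0; first by rewrite !mul0r.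
  rewrite -PE // -QE //; have [->|->] := pq (g t) (ex_intro2 _ _ t Dt erefl).
    by rewrite !(mulr0, mul0r).
  by rewrite !mulr0.
move/eqP; rewrite !mulf_eq0 (negPf D0) /= => /orP[/eqP P0|/eqP Q0]; [left|right];
  move=> _ [t Dt ->]; apply/eqP.
  by have /eqP := PE t Dt; rewrite P0 horner0 mulf_eq0 expf_eq0 (negPf Dt) andbF.
by have /eqP := QE t Dt; rewrite Q0 horner0 mulf_eq0 expf_eq0 (negPf Dt) andbF.
Qed.

End Irreducible.

(** * Orbits of the group generated by connected algebraic subgroups *)

Section AutAlg.
Variables (K : fieldType) (n : nat) (X : {pred 'rV[K]_n}).

Lemma Aut_alg_id : Aut_alg (@id (pts X)).
Proof. by move=> H [_ H1 _ _] _. Qed.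

Lemma Aut_alg_comp (f g : pts X -> pts X) :
  Aut_alg f -> Aut_alg g -> Aut_alg (f \o g).
Proof.
move=> Af Ag H HH Hgen; have [_ _ HM _] := HH.
by apply: HM; [apply: Af | apply: Ag].
Qed.

Lemma Aut_alg_inv (f g : pts X -> pts X) :
  Aut_alg f -> cancel f g -> cancel g f -> Aut_alg g.
Proof.
move=> Af fK gK H HH Hgen; have [_ _ _ HV] := HH.
by apply: (HV f g) => //; apply: Af.
Qed.

Lemma is_aut_id : is_aut (@id (pts X)).
Proof.
have idm : Defs.morphism (@id (pts X)).
  have [F FE] := polymapP (@polymap_id K n).
  by exists F => x; rewrite -FE.
by split=> //; exists id.
Qed.

Lemma is_aut_comp (f g : pts X -> pts X) :
  is_aut f -> is_aut g -> is_aut (f \o g).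
Proof.
have comp_m (h k : pts X -> pts X) :
    Defs.morphism h -> Defs.morphism k -> Defs.morphism (h \o k).
  move=> [F FE] [G GE]; exists (fun j => mpoly_subst (F j) G) => x /=.
  by rewrite FE GE; apply/rowP => j; rewrite !mxE peval_comp.
move=> [fm [f' [f'm fK f'K]]] [gm [g' [g'm gK g'K]]]; split; first exact: comp_m.
exists (g' \o f'); split; first exact: comp_m.
  exact: can_comp.
exact: can_comp.
Qed.

Lemma is_aut_inv (f g : pts X -> pts X) :
  is_aut f -> cancel f g -> cancel g f -> is_aut g.
Proof.
move=> [fm [f' [[F FE] fK f'K]]] gK gK'.
have ff' : f' =1 g by move=> x; rewrite -{1}(gK' x) fK.
by split; [exists F => x; rewrite -ff' FE | exists f].
Qed.

(** Aut_alg(X) lies in every subgroup that contains the connected algebraic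
    ones, and the group of all automorphisms is one. *)
Lemma Aut_alg_aut (f : pts X -> pts X) : Aut_alg f -> is_aut f.
Proof.
apply; last by move=> G [[GA _ _ _] _] g /GA.
split=> //; [exact: is_aut_id | exact: is_aut_comp | exact: is_aut_inv].
Qed.

(** Orbits are compared on coordinate vectors, since the moves that connect
    points are given by formulas in coordinates. *)
Definition same_orbit (x y : 'rV[K]_n) :=
  exists2 f : pts X -> pts X, Aut_alg f &
  exists2 x', val x' = x & val (f x') = y.

Lemma same_orbit_refl (x : pts X) : same_orbit (val x) (val x).
Proof. by exists id; [exact: Aut_alg_id | exists x]. Qed.

Lemma same_orbit_trans x y z : same_orbit x y -> same_orbit y z -> same_orbit x z.
Proof.
move=> [f Af [x' x'E fE]] [g Ag [y' y'E gE]].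
exists (g \o f); first exact: Aut_alg_comp.
exists x' => //=; rewrite -gE; congr (val (g _)).
by apply: val_inj; rewrite fE.
Qed.

Lemma same_orbit_sym x y : same_orbit x y -> same_orbit y x.
Proof.
move=> [f Af [x' x'E fE]]; have [_ [g [_ fK gK]]] := Aut_alg_aut Af.
exists g; first exact: Aut_alg_inv Af fK gK.
by exists (f x') => //; rewrite fK.
Qed.

Lemma same_orbitP (x y : pts X) :
  same_orbit (val x) (val y) <-> exists2 f, Aut_alg f & f x = y.
Proof.
split=> [[f Af [x' /val_inj-> /val_inj]]|[f Af <-]]; first by exists f.
by exists f => //; exists x.
Qed.

Lemma same_orbit_in x y : same_orbit x y -> x \in X /\ y \in X.
Proof. by move=> [f _ [x' <- <-]]; split; apply: valP. Qed.

End AutAlg.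

Section AlgebraicAction.
Variables (K : fieldType) (n m : nat) (X : {pred 'rV[K]_n}) (ps : seq {mpoly K[m]}).
Variables (act : 'rV[K]_m -> 'rV[K]_n -> 'rV[K]_n) (mul : 'rV[K]_m -> 'rV[K]_m -> 'rV[K]_m).
Variables (inv : 'rV[K]_m -> 'rV[K]_m) (one : 'rV[K]_m).
Let S := zeros ps.
Hypothesis S_conn : zconnected (fun s => s \in S).
Hypothesis oneS : one \in S.
Hypothesis mulS : forall s t, s \in S -> t \in S -> mul s t \in S.
Hypothesis invS : forall s, s \in S -> inv s \in S.
Hypothesis mulV : forall s, s \in S -> mul (inv s) s = one /\ mul s (inv s) = one.
Hypothesis actX : forall s x, s \in S -> x \in X -> act s x \in X.
Hypothesis act1 : forall x, x \in X -> act one x = x.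
Hypothesis actM : forall s t x, s \in S -> t \in S -> x \in X ->
  act (mul s t) x = act s (act t x).
Hypothesis act_faithful : forall s t, s \in S -> t \in S ->
  (forall x, x \in X -> act s x = act t x) -> s = t.
Hypothesis act_poly : polymap (fun w : 'rV[K]_(m + n) => act (lsubmx w) (rsubmx w)).
Hypothesis mul_poly : polymap (fun w : 'rV[K]_(m + m) => mul (lsubmx w) (rsubmx w)).
Hypothesis inv_poly : polymap inv.

(** Faithfulness identifies S with the group of automorphisms by which it acts,
    which is therefore a connected algebraic subgroup. *)
Lemma connected_action_same_orbit s x : s \in S -> x \in X ->
  same_orbit X x (act s x).
Proof.
move=> sS xX.
pose rho (s : pts S) (x : pts X) : pts X := exist (fun y => y \in X) _ (actX (valP s) (valP x)).
pose pmul (s t : pts S) : pts S := exist (fun s => s \in S) _ (mulS (valP s) (valP t)).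
pose pinv (s : pts S) : pts S := exist (fun s => s \in S) _ (invS (valP s)).
have rhoM u v : rho (pmul u v) =1 rho u \o rho v.
  by move=> y; apply: val_inj; apply: actM; apply: valP.
have rhoK u : cancel (rho u) (rho (pinv u)).
  move=> y; apply: val_inj; rewrite /= -actM ?(mulV (valP u)).1 ?act1 ?invS //;
  exact: valP.
have rhoVK u : cancel (rho (pinv u)) (rho u).
  move=> y; apply: val_inj; rewrite /= -actM ?(mulV (valP u)).2 ?act1 ?invS //;
  exact: valP.
have rho_morph u : Defs.morphism (rho u).
  have [F FE] := @polymapP K n n (act (val u)) (fun j =>
    polyfun_ext (fun x => congr1 (fun y : 'rV[K]_n => y 0 j)
       (congr2 act (row_mxKl (val u) x) (row_mxKr (val u) x)))
    (polyfun_comp (act_poly j) (polymap_row_mx (@polymap_cst _ n _ (val u)) (@polymap_id _ _)))).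
  by exists F => y; rewrite /= FE.
exists (rho (exist _ s sS)); last by exists (exist _ x xX).
move=> H HH Hgen; apply: (Hgen (fun f => exists u, rho u =1 f));
  last by exists (exist _ s sS).
split.
  split.
  - move=> f [u uf]; have [F FE] := rho_morph u; have [G GE] := rho_morph (pinv u).
    split; first by exists F => y; rewrite -uf.
    exists (rho (pinv u)); split; first by exists G.
      by move=> y; rewrite -uf rhoK.
    by move=> y; rewrite -uf rhoVK.
  - by exists (exist _ one oneS) => y; apply: val_inj; apply: act1; apply: valP.
  - by move=> f g [u uf] [v vg]; exists (pmul u v) => y; rewrite rhoM /= vg uf.
  - move=> f g [u uf] fK gK; exists (pinv u) => y.
    by rewrite -{1}(gK y) -uf rhoK.
exists m, ps, rho, pmul, pinv; split=> //.
- split=> // u v uv; apply: val_inj; apply: act_faithful; try exact: valP.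
  by move=> y yX; have := congr1 val (uv (exist _ y yX)).
- split=> //; have [F FE] := polymapP mul_poly.
  by exists F => u v; rewrite -FE row_mxKl row_mxKr.
- split=> //; have [F FE] := polymapP inv_poly.
  by exists F => u; rewrite -FE.
- have [F FE] := polymapP act_poly.
  by exists F => u v; rewrite -FE row_mxKl row_mxKr.
Qed.

End AlgebraicAction.

(** * The additive and the multiplicative group *)

Section ConnectedGroups.
Variable K : fieldType.
Hypothesis charK0 : [pchar K] =i pred0.

Lemma zconnected_ext n (S S' : 'rV[K]_n -> Prop) :
  (forall x, S x <-> S' x) -> zconnected S -> zconnected S'.
Proof.
move=> SS' [[x Sx] conn]; split; first by exists x; apply/SS'.
move=> ps qs cover disj; case: (conn ps qs) => [y /SS'|y /SS'|H|H].
- exact: cover.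
- exact: disj.
- by left=> y /SS'/H.
- by right=> y /SS'/H.
Qed.

Lemma zconnected_additive : zconnected (fun s : 'rV[K]_1 => s \in zeros [::]).
Proof.
have gP i : ratfun 1 (fun t => (const_mx t : 'rV[K]_1) 0 i).
  by exists 'X, 0%N => t _; rewrite mul1r mxE hornerX.
apply: zconnected_ext (rational_curve_zconnected charK0 (g := fun t => const_mx t) (oner_neq0 _) gP).
move=> x; split=> // _; exists (x 0 0); first by rewrite hornerC oner_neq0.
by apply/rowP => j; rewrite mxE ord1.
Qed.

(** The multiplicative group, as a closed subset of the plane. *)
Definition hyperbola : seq {mpoly K[2]} := [:: 'X_0 * 'X_1 - 1].

Lemma in_hyperbola s : (s \in zeros hyperbola) = (s 0 0 * s 0 1 == 1).
Proof.
by rewrite inE /= andbT /peval mevalB mevalM !mevalXU meval1 subr_eq0.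
Qed.

Definition pair_row (u v : K) : 'rV[K]_2 := \row_j if j == 0 then u else v.

Lemma pair_row0 u v : pair_row u v 0 0 = u. Proof. by rewrite mxE. Qed.
Lemma pair_row1 u v : pair_row u v 0 1 = v. Proof. by rewrite mxE. Qed.

Lemma pair_row_eta (s : 'rV[K]_2) : s = pair_row (s 0 0) (s 0 1).
Proof.
apply/rowP => j; rewrite mxE; case: eqP => [->//|/eqP j0].
by congr (s _ _); apply: val_inj; case: j j0 => -[|[|]].
Qed.

Lemma zconnected_hyperbola : zconnected (fun s => s \in zeros hyperbola).
Proof.
have gP i : ratfun 'X (fun t => pair_row t t^-1 0 i).
  case: (eqVneq i 0) => [->|i0].
    by exists 'X, 0%N => t _; rewrite mul1r pair_row0 hornerX.
  exists 1, 1%N => t; rewrite hornerX hornerC expr1 mxE (negPf i0).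
  exact: divff.
apply: zconnected_ext (rational_curve_zconnected charK0 (g := fun t => pair_row t t^-1) (negbT (polyX_eq0 _)) gP).
move=> x; rewrite in_hyperbola; split=> [[t t0 ->]|/eqP x1].
  by rewrite pair_row0 pair_row1 divff // -[t]hornerX.
have x0 : x 0 0 != 0 by apply/eqP => x0; move/eqP: x1; rewrite x0 mul0r eq_sym oner_eq0.
exists (x 0 0); first by rewrite hornerX.
rewrite {1}[x]pair_row_eta; congr pair_row.
by apply: (mulfI x0); rewrite x1 divff.
Qed.

(** By Bezout. *)
Lemma expr_coprime_eq1 (w : K) a b : coprime a b -> w ^+ a = 1 -> w ^+ b = 1 -> w = 1.
Proof.
case: a => [|a]; first by rewrite /coprime gcd0n => /eqP ->; rewrite expr1.
move=> cab wa wb; case: (egcdnP b (ltn0Sn a)) => km kn E _.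
have : w ^+ (km * a.+1) = 1 by rewrite mulnC exprM wa expr1n.
by rewrite E (eqP cab) addn1 exprS mulnC exprM wb expr1n mulr1.
Qed.

End ConnectedGroups.

(** * Difference quotients of a power *)

(** The increment of z^d along a step s w, divided by w. *)
Definition difference_quotient (K : fieldType) (d : nat) (w s z : K) : K :=
  s * \sum_(i < d) (z + s * w) ^+ (d.-1 - i) * z ^+ i.

Lemma difference_quotientE (K : fieldType) d (w s z : K) :
  w * difference_quotient d w s z = (z + s * w) ^+ d - z ^+ d.
Proof.
by rewrite subrXX addrAC subrr add0r /difference_quotient mulrA [w * s]mulrC.
Qed.

Lemma difference_quotient0 (K : fieldType) d (s z : K) :
  difference_quotient d 0 s z = s * (z ^+ d.-1 *+ d).
Proof.
rewrite /difference_quotient mulr0 addr0; congr (_ * _).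
rewrite (eq_bigr (fun=> z ^+ d.-1)) ?sumr_const ?card_ord // => i _.
by rewrite -exprD subnK // -ltnS (ltn_predK (ltn_ord i)).
Qed.

(** Both sides have the same product with w, which settles the case where w is
    nonzero; for w = 0 both are linear in the time. *)
Lemma difference_quotientD (K : fieldType) d (w s t z : K) :
  difference_quotient d w (s + t) z
  = difference_quotient d w t z + difference_quotient d w s (z + t * w).
Proof.
have [->|w0] := eqVneq w 0.
  by rewrite !difference_quotient0 mulr0 addr0 -mulrDl addrC.
apply: (mulfI w0); rewrite mulrDr !difference_quotientE.
have -> : z + (s + t) * w = z + t * w + s * w by ring.
by rewrite [RHS]addrC addrA subrK.
Qed.

(** * Singular points of a trinomial hypersurface *)

(** The variable x_k belongs to the monomial number blk k, with exponent e k.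
    All exponents are at least 2, so that the differential of a monomial
    vanishes wherever the monomial does. *)
Section TrinomialHypersurface.
Variables (K : closedFieldType) (N : nat) (blk : 'I_N -> 'I_3) (e : 'I_N -> nat).
Hypothesis charK0 : [pchar K] =i pred0.
Hypothesis e_ge2 : forall k, (1 < e k)%N.
Hypothesis blk_surj : forall i, exists k, blk k = i.

Definition monomial_poly (i : 'I_3) : {mpoly K[N]} :=
  \prod_(k | blk k == i) 'X_k ^+ e k.

Definition trinomial_poly : {mpoly K[N]} := \sum_i monomial_poly i.

Definition monomial (i : 'I_3) (x : 'rV[K]_N) : K :=
  \prod_(k | blk k == i) x 0 k ^+ e k.

Lemma peval_monomial i x : peval (monomial_poly i) x = monomial i x.
Proof.
rewrite /peval rmorph_prod; apply: eq_bigr => k _.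
by rewrite rmorphXn /= mevalXU.
Qed.

Lemma peval_trinomial x : peval trinomial_poly x = \sum_i monomial i x.
Proof.
rewrite /peval rmorph_sum; apply: eq_bigr => i _; exact: peval_monomial.
Qed.

Definition hypersurface : {pred 'rV[K]_N} := zeros [:: trinomial_poly].

Lemma in_hypersurface x : (x \in hypersurface) = (\sum_i monomial i x == 0).
Proof. by rewrite inE /= andbT peval_trinomial. Qed.

(** The cofactor of the power of x_j in the monomial to which x_j belongs. *)
Definition comonomial_poly (j : 'I_N) : {mpoly K[N]} :=
  \prod_(k | (blk k == blk j) && (k != j)) 'X_k ^+ e k.

Definition comonomial (j : 'I_N) (x : 'rV[K]_N) : K :=
  \prod_(k | (blk k == blk j) && (k != j)) x 0 k ^+ e k.

Lemma peval_comonomial j x : peval (comonomial_poly j) x = comonomial j x.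
Proof.
rewrite /peval rmorph_prod; apply: eq_bigr => k _.
by rewrite rmorphXn /= mevalXU.
Qed.

Lemma monomial_comonomial j x : monomial (blk j) x = x 0 j ^+ e j * comonomial j x.
Proof. by rewrite /monomial (bigD1 j). Qed.

Definition rest_poly (j : 'I_N) : {mpoly K[N]} :=
  \sum_(i | i != blk j) monomial_poly i.

Lemma trinomial_poly_split j :
  trinomial_poly = comonomial_poly j * 'X_j ^+ e j + rest_poly j.
Proof.
rewrite /trinomial_poly (bigD1 (blk j)) //=; congr (_ + _).
by rewrite /monomial_poly (bigD1 j) //= mulrC.
Qed.

Lemma uni_prod_free (j : 'I_N) (P : pred 'I_N) : ~~ P j ->
  uni j (\prod_(k | P k) 'X_k ^+ e k : {mpoly K[N]}) = (\prod_(k | P k) 'X_k ^+ e k)%:P.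
Proof.
move=> nPj; rewrite !rmorph_prod; apply: eq_bigr => k Pk.
rewrite !rmorphXn /= uniX; case: eqP => // kj.
by rewrite -kj Pk in nPj.
Qed.

Lemma uni_comonomial j : uni j (comonomial_poly j) = (comonomial_poly j)%:P.
Proof. by apply: uni_prod_free; rewrite /= !eqxx. Qed.

Lemma uni_rest j : uni j (rest_poly j) = (rest_poly j)%:P.
Proof.
rewrite /rest_poly !rmorph_sum; apply: eq_bigr => i ij.
by apply: uni_prod_free; rewrite /= eq_sym.
Qed.

Lemma mderiv_trinomial j :
  trinomial_poly^`M(j) = comonomial_poly j * 'X_j ^+ (e j).-1 *+ e j.
Proof.
rewrite mderiv_uni {1}(trinomial_poly_split j) uniD uniM uni_comonomial uni_rest.
rewrite rmorphXn /= uniX eqxx derivD derivC addr0 mul_polyC derivZ derivXn.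
by rewrite hornerZ hornerMn hornerXn mulrnAr.
Qed.

Definition ones : 'rV[K]_N := const_mx 1.

Lemma monomial_ones i : monomial i ones = 1.
Proof. by rewrite /monomial big1 // => k _; rewrite mxE expr1n. Qed.

Lemma comonomial_poly_neq0 j : comonomial_poly j != 0.
Proof.
apply/eqP => c0; have := peval_comonomial j ones.
rewrite c0 /peval meval0 /comonomial big1 => [/eqP|k _]; last by rewrite mxE expr1n.
by rewrite eq_sym oner_eq0.
Qed.

Lemma natr_neq0 m : (0 < m)%N -> (m%:R : K) != 0.
Proof. by rewrite ((pcharf0P K).1 charK0) lt0n. Qed.

Lemma rest_poly_neq0 j : rest_poly j != 0.
Proof.
apply/eqP => c0; have : peval (rest_poly j) ones = 2%:R.
  rewrite /peval rmorph_sum /= (eq_bigr (fun=> 1)) => [|i _].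
    rewrite sumr_const; congr (_%:R).
    transitivity #|predC1 (blk j)|; last by rewrite cardC1 card_ord.
    by apply: eq_card => i; rewrite !inE.
  by rewrite -/(peval _ _) peval_monomial monomial_ones.
rewrite c0 /peval meval0 => /eqP; rewrite eq_sym; apply/negP.
exact: natr_neq0.
Qed.


Lemma trinomial_vanishing_divisible j p : vanishes_on hypersurface p ->
  exists k q, comonomial_poly j ^+ k * p = q * trinomial_poly.
Proof.
rewrite /hypersurface (trinomial_poly_split j); apply: (vanishing_divisible charK0).
- exact: ltnW.
- exact: comonomial_poly_neq0.
- exact: rest_poly_neq0.
- exact: uni_comonomial.
- exact: uni_rest.
Qed.

(** For p vanishing on X, some a^k p is a multiple of the equation f, where a
    is the cofactor of x_j; as a does not vanish at x, dp is proportional to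
    df. *)
Lemma trinomial_tangent j x v : x \in hypersurface -> comonomial j x != 0 ->
  differential trinomial_poly x v = 0 -> tangent hypersurface x v.
Proof.
move=> xX cj dv p pX; have [k [q E]] := trinomial_vanishing_divisible j pX.
apply: (differential_divisible _ _ _ E dv); rewrite ?peval_comonomial //; first exact: pX.
by apply/eqP; rewrite peval_trinomial -in_hypersurface.
Qed.

Lemma monomial_upd x (j : 'I_N) t i : i != blk j ->
  monomial i (upd x j t) = monomial i x.
Proof.
move=> ij; apply: eq_bigr => k /eqP bk; rewrite updE.
by case: eqP => // kj; rewrite -bk kj eqxx in ij.
Qed.

Lemma comonomial_upd x (j : 'I_N) t : comonomial j (upd x j t) = comonomial j x.
Proof.
by apply: eq_bigr => k /andP[_ /negPf kj]; rewrite updE kj.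
Qed.

Definition singular (x : 'rV[K]_N) := forall i, monomial i x = 0.

(** If the cofactor of x_j vanishes at x, the line through x parallel to the
    j-th axis lies on X. Otherwise dp is proportional to df, which is zero at x
    because all exponents are at least 2. *)
Lemma singular_tangent x v : singular x -> tangent hypersurface x v.
Proof.
move=> sx; have xX : x \in hypersurface by rewrite in_hypersurface big1.
move=> p pX; apply: big1 => j _; suff -> : peval p^`M(j) x = 0 by rewrite mul0r.
have [cj0|cj] := eqVneq (comonomial j x) 0.
  rewrite peval_mderiv; set P := map_poly _ _.
  suff -> : P = 0 by rewrite deriv0 horner0.
  apply: (@poly_eq0_vanish K charK0 _ idfun) => t /=.
  rewrite uni_peval; apply: pX; rewrite in_hypersurface big1 // => i _.
  have [->|ij] := eqVneq i (blk j); last by rewrite monomial_upd.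
  by rewrite monomial_comonomial comonomial_upd cj0 mulr0.
have := @trinomial_tangent j x (delta_mx 0 j) xX cj; rewrite /differential /tangent.
have dE (q : {mpoly K[N]}) : \sum_(i < N) peval q^`M(i) x * (delta_mx 0 j : 'rV[K]_N) 0 i
    = peval q^`M(j) x.
  rewrite (bigD1 j) //= mxE !eqxx mulr1 big1 ?addr0 // => i ij.
  by rewrite mxE eqxx (negPf ij) mulr0.
rewrite dE => H; rewrite -dE; apply: H => //.
have := sx (blk j); rewrite monomial_comonomial => /eqP.
rewrite mulf_eq0 (negPf cj) orbF expf_eq0 => /andP[_ /eqP xj].
rewrite mderiv_trinomial /peval mevalMn mevalM rmorphXn /= mevalXU xj expr0n.
by case: (e j) (e_ge2 j) => [|[|m]] //; rewrite mulr0 mul0rn.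
Qed.

(** Where a monomial is nonzero so is its differential, and the tangent space
    is the hyperplane df = 0; where all three monomials vanish it is the whole
    space. *)
Lemma regularP (x : pts hypersurface) :
  regular_point N.-1 x <-> ~ singular (val x).
Proof.
split=> [[V [VT rkV]] sx|nsx].
  have V1 : (1%:M <= V)%MS.
    by apply/row_subP => i; apply/VT; apply: singular_tangent.
  have := mxrankS V1; rewrite mxrank1 rkV.
  suff /prednK {1}<- : (0 < N)%N by rewrite ltnn.
  by have [j _] := blk_surj 0; exact: leq_ltn_trans (ltn_ord j).
have [i Mi] : exists i, monomial i (val x) != 0.
  by apply: NNPP => H; apply: nsx => i; apply/eqP; apply/negPn/negP => Mi; apply: H; exists i.
have [j bj] := blk_surj i; subst i.
move: Mi; rewrite monomial_comonomial mulf_eq0 negb_or => /andP[].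
rewrite expf_eq0 (ltnW (e_ge2 j)) /= => xj cj.
pose c := \col_k peval trinomial_poly^`M(k) (val x).
have cE v : v *m c = const_mx (differential trinomial_poly (val x) v).
  apply/matrixP => a b; rewrite !mxE; apply: eq_bigr => k _.
  by rewrite mxE mulrC ord1.
exists (kermx c); split; last first.
  rewrite mxrank_ker -subn1; congr (_ - _)%N.
  apply/eqP; rewrite eqn_leq rank_leq_col lt0n mxrank_eq0.
  apply/eqP => /matrixP/(_ j 0); rewrite !mxE mderiv_trinomial => /eqP.
  rewrite /peval mevalMn mevalM rmorphXn /= mevalXU -/(peval _ _) peval_comonomial.
  rewrite -mulr_natr !mulf_eq0 (negPf cj) expf_eq0 (negPf xj) andbF /=.
  by apply/negP/natr_neq0/ltnW.
move=> v; rewrite (sameP sub_kermxP eqP) cE; split=> [/eqP/matrixP/(_ 0 0)|Tv].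
  by rewrite !mxE => dv; apply: (trinomial_tangent _ cj dv); apply: valP.
rewrite -(_ : const_mx 0 = 0); last by apply/matrixP => a b; rewrite !mxE.
apply/eqP; congr const_mx; apply: Tv => y; rewrite inE /= andbT => /eqP //.
Qed.

Local Notation X := hypersurface.
Local Notation "x ~ y" := (same_orbit X x y) (at level 70).

Lemma monomial_eq i (x y : 'rV[K]_N) :
  (forall k, blk k = i -> x 0 k = y 0 k) -> monomial i x = monomial i y.
Proof. by move=> xy; apply: eq_bigr => k /eqP bk; rewrite xy. Qed.

Lemma hypersurface_monomials x y : (forall i, monomial i x = monomial i y) ->
  (x \in X) = (y \in X).
Proof. by move=> H; rewrite !in_hypersurface (eq_bigr _ (fun i _ => H i)). Qed.

(** All coordinates are 1 except one, the power of which in the equation is -2.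
    *)
Lemma generic_point : exists2 x, x \in X & forall k, x 0 k != 0.
Proof.
have [j bj] := blk_surj 0; have [t tE] := exists_root (- 2%:R : K) (ltnW (e_ge2 j)).
have t0 : t != 0.
  apply/eqP => t0; move/eqP: tE; rewrite t0 expr0n gtn_eqF ?(ltnW (e_ge2 j)) //.
  by rewrite eq_sym oppr_eq0; apply/negP/natr_neq0.
exists (upd ones j t); last first.
  by move=> k; rewrite updE; case: (k == j) => //; rewrite mxE oner_neq0.
rewrite in_hypersurface (bigD1 0) //= -bj monomial_comonomial comonomial_upd updE eqxx tE.
rewrite (eq_bigr (fun=> 1)) => [|i i0]; last by rewrite monomial_upd // monomial_ones.
rewrite sumr_const /comonomial big1 => [|k _]; last by rewrite mxE expr1n.
rewrite (_ : #|_| = 2); first by rewrite mulr1 addNr.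
transitivity #|predC1 (blk j)|; last by rewrite cardC1 card_ord.
by apply: eq_card => i; rewrite !inE.
Qed.

(** * Rescaling two variables of a monomial *)

Section Scaling.
Variables (j k : 'I_N) (jk : j != k) (bjk : blk j = blk k) (a b : nat).
Hypotheses (cab : coprime a b) (abe : (a * e j = b * e k)%N).

(** A one-parameter torus rescaling x_j and x_k in opposite ways. *)
Definition scale2 (s : 'rV[K]_2) (x : 'rV[K]_N) : 'rV[K]_N :=
  \row_i (if i == j then s 0 0 ^+ a * x 0 i else
          if i == k then s 0 1 ^+ b * x 0 i else x 0 i).

Lemma scale2_monomial s x i : s \in zeros (hyperbola K) ->
  monomial i (scale2 s x) = monomial i x.
Proof.
rewrite in_hyperbola => /eqP s1.
have [->|ij] := eqVneq i (blk j); last first.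
  apply: monomial_eq => h bh; rewrite mxE.
  case: eqP => [hj|_]; first by rewrite -bh hj eqxx in ij.
  by case: eqP => // hk; rewrite -bh hk bjk eqxx in ij.
have split2 (y : 'rV[K]_N) : monomial (blk j) y = y 0 j ^+ e j * (y 0 k ^+ e k *
    \prod_(h | (blk h == blk j) && (h != j) && (h != k)) y 0 h ^+ e h).
  rewrite /monomial (bigD1 j) //=; congr (_ * _); rewrite (bigD1 k) //=.
  by rewrite bjk eqxx eq_sym.
rewrite !split2 !mxE eqxx [k == j]eq_sym (negPf jk) eqxx !exprMn -!exprM abe.
rewrite (eq_bigr (fun h => x 0 h ^+ e h)) => [|h]; last first.
  by rewrite mxE => /andP[/andP[_ /negPf->] /negPf->].
set p := \prod_(_ | _) _; have: s 0 0 ^+ (b * e k) * s 0 1 ^+ (b * e k) = 1.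
  by rewrite -exprMn s1 expr1n.
move: (s 0 0 ^+ _) (s 0 1 ^+ _) => c d cd.
transitivity ((c * d) * (x 0 j ^+ e j * (x 0 k ^+ e k * p))); first by ring.
by rewrite cd mul1r.
Qed.

Lemma scale2_same_orbit s x : s \in zeros (hyperbola K) -> x \in X -> x ~ scale2 s x.
Proof.
pose mul (s t : 'rV[K]_2) : 'rV[K]_2 := \row_i (s 0 i * t 0 i).
pose inv (s : 'rV[K]_2) : 'rV[K]_2 := pair_row (s 0 1) (s 0 0).
apply: (connected_action_same_orbit (mul := mul) (inv := inv) (one := const_mx 1)).
- exact: zconnected_hyperbola charK0.
- by rewrite in_hyperbola !mxE mulr1.
- move=> u v; rewrite !in_hyperbola !mxE mulrACA => /eqP-> /eqP->.
  by rewrite mulr1.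
- by move=> u; rewrite !in_hyperbola pair_row0 pair_row1 mulrC.
- move=> u; rewrite in_hyperbola => /eqP u1.
  split; rewrite [LHS]pair_row_eta [RHS]pair_row_eta !mxE /=.
    by rewrite u1 mulrC u1.
  by rewrite [u 0 1 * _]mulrC u1.
- by move=> u y uS yX; rewrite (@hypersurface_monomials _ y) // => i; exact: scale2_monomial.
- move=> y _; apply/rowP => i; rewrite !mxE !expr1n !mul1r.
  by case: (i == j) => //; case: (i == k).
- move=> u v y _ _ _; apply/rowP => i; rewrite !mxE !exprMn.
  by case: (i == j); [rewrite mulrA | case: (i == k); rewrite ?mulrA].
- move=> u v; rewrite !in_hyperbola => /eqP u1 /eqP v1 uv.
  have [y yX y0] := generic_point; have /rowP yE := uv y yX.
  have := yE j; rewrite !mxE eqxx => /(mulIf (y0 j)) E0.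
  have := yE k; rewrite !mxE eqxx eq_sym (negPf jk) => /(mulIf (y0 k)) E1.
  have u0 : u 0 0 != 0 by apply/eqP=> h; move/eqP: u1; rewrite h mul0r eq_sym oner_eq0.
  have v0 : v 0 0 != 0 by apply/eqP=> h; move/eqP: v1; rewrite h mul0r eq_sym oner_eq0.
  have uE : u 0 1 = (u 0 0)^-1 by apply: (mulfI u0); rewrite u1 divff.
  have vE : v 0 1 = (v 0 0)^-1 by apply: (mulfI v0); rewrite v1 divff.
  have uv0 : u 0 0 = v 0 0.
    apply: (divIf v0); rewrite divff //; apply: (expr_coprime_eq1 cab).
      by rewrite expr_div_n E0 divff // expf_neq0.
    have : (u 0 0)^-1 ^+ b = (v 0 0)^-1 ^+ b by rewrite -uE -vE.
    by rewrite !exprVn => /invr_inj E; rewrite expr_div_n E divff // expf_neq0.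
  by rewrite [u]pair_row_eta [v]pair_row_eta uE vE uv0.
- move=> i.
  have l0 : polyfun (fun w : 'rV[K]_(2 + N) => lsubmx w 0 0) by exact: polyfun_lsub.
  have l1 : polyfun (fun w : 'rV[K]_(2 + N) => lsubmx w 0 1) by exact: polyfun_lsub.
  have r : polyfun (fun w : 'rV[K]_(2 + N) => rsubmx w 0 i) by exact: polyfun_rsub.
  have [ij|ij] := boolP (i == j).
    apply: polyfun_ext (polyfunM (polyfun_exp a l0) r) => w.
    by rewrite [RHS]mxE ij.
  have [ik|ik] := boolP (i == k).
    apply: polyfun_ext (polyfunM (polyfun_exp b l1) r) => w.
    by rewrite [RHS]mxE (negPf ij) ik.
  by apply: polyfun_ext r => w; rewrite [RHS]mxE (negPf ij) (negPf ik).
- move=> i; apply: polyfun_ext (polyfunM (polyfun_lsub _ _ i) (polyfun_rsub _ _ i)) => w.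
  by rewrite [RHS]mxE.
- move=> i; have [i0|i0] := boolP (i == 0).
    by apply: polyfun_ext (polyfunX _ 1) => w; rewrite [RHS]mxE i0.
  by apply: polyfun_ext (polyfunX _ 0) => w; rewrite [RHS]mxE (negPf i0).
Qed.

End Scaling.

(** Any coordinate can be rescaled at the expense of another one from the same
    monomial. Dividing the two exponents by their gcd makes the action of the
    multiplicative group faithful. *)
Lemma rescale (j k : 'I_N) (t : K) x : j != k -> blk j = blk k -> t != 0 -> x \in X ->
  exists2 c, c ^+ (e k %/ gcdn (e j) (e k)) * t ^+ (e j %/ gcdn (e j) (e k)) = 1 &
    x ~ upd (upd x j (t * x 0 j)) k (c * x 0 k).
Proof.
move=> jk bjk t0 xX; set g := gcdn _ _.
have ej0 : (0 < e j)%N by apply: ltnW.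
have ek0 : (0 < e k)%N by apply: ltnW.
have g0 : (0 < g)%N by rewrite gcdn_gt0 ej0.
set a := (e k %/ g)%N; set b := (e j %/ g)%N.
have ag : (a * g = e k)%N by rewrite divnK // dvdn_gcdr.
have bg : (b * g = e j)%N by rewrite divnK // dvdn_gcdl.
have a0 : (0 < a)%N by rewrite divn_gt0 // dvdn_leq // dvdn_gcdr.
have cab : coprime a b.
  by rewrite /coprime -(eqn_pmul2r g0) muln_gcdl ag bg mul1n gcdnC.
have abe : (a * e j = b * e k)%N by rewrite -ag -bg mulnCA.
have [u uE] := exists_root t a0.
have u0 : u != 0.
  by apply/eqP => u0; move: t0; rewrite -uE u0 expr0n gtn_eqF // eqxx.
exists (u^-1 ^+ b).
  by rewrite -uE -!exprM [(a * b)%N]mulnC -exprMn mulVf // expr1n.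
have sS : pair_row u u^-1 \in zeros (hyperbola K).
  by rewrite in_hyperbola pair_row0 pair_row1 divff.
have := scale2_same_orbit jk bjk cab abe sS xX.
congr (same_orbit _ _ _); apply/rowP => i.
rewrite !mxE /= uE; have [->|ij] := eqVneq i j; first by rewrite (negPf jk).
by case: eqP => // ->.
Qed.

(** * Flows of locally nilpotent derivations *)

Definition even_block i := forall k, blk k = i -> ~~ odd (e k).

(** In a monomial all of whose exponents are even, the square root of the
    cofactor of x_j. *)
Definition root_comonomial (j : 'I_N) (x : 'rV[K]_N) : K :=
  \prod_(k | (blk k == blk j) && (k != j)) x 0 k ^+ (e k)./2.
Local Notation rc := root_comonomial.

Lemma monomial_square j x : even_block (blk j) -> e j = 2 ->
  monomial (blk j) x = (rc j x * x 0 j) ^+ 2.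
Proof.
move=> evj ej; rewrite monomial_comonomial ej exprMn mulrC; congr (_ * _).
rewrite /comonomial /rc -prodrXl; apply: eq_bigr => k /andP[/eqP bk _].
by rewrite -exprM muln2 even_halfK // evj.
Qed.

Lemma sum_ord3 (F : 'I_3 -> K) i j k : i != j -> i != k -> j != k ->
  \sum_h F h = F i + F j + F k.
Proof.
move=> ij ik jk; rewrite (bigD1 i) //= (bigD1 j) 1?eq_sym //= (bigD1 k) /=; last first.
  by rewrite eq_sym ik eq_sym jk.
rewrite big_pred0 ?addr0 ?addrA // => h.
apply/negbTE; move: ij ik jk; rewrite -!val_eqE /=.
by case: h i j k => -[|[|[|h]]] ? [[|[|[|i]]] ?] [[|[|[|j]]] ?] [[|[|[|k]]] ?].
Qed.

(** The choice of variables that defines a flow: x_a and x_b are squared in two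
    monomials that are themselves squares and x_c belongs to the third one, so
    that the equation takes the form (A x_a)^2 + (B x_b)^2 + C x_c^d = 0 with
    A, B, C free of x_a, x_b, x_c. *)
Record roles (a b c : 'I_N) : Prop := Roles {
  roles_ab : blk a != blk b; roles_ac : blk a != blk c; roles_bc : blk b != blk c;
  roles_ea : e a = 2; roles_eb : e b = 2;
  roles_eva : even_block (blk a); roles_evb : even_block (blk b) }.

Section Coordinates.
Variables (a b c : 'I_N).
Hypothesis abc : roles a b c.
Variable iota : K.
Hypothesis iota2 : iota ^+ 2 = -1.

Let blk_ab := roles_ab abc.
Let blk_ac := roles_ac abc.
Let blk_bc := roles_bc abc.

Let ab : a != b. Proof. by apply: contraNneq blk_ab => ->. Qed.
Let ac : a != c. Proof. by apply: contraNneq blk_ac => ->. Qed.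
Let bc : b != c. Proof. by apply: contraNneq blk_bc => ->. Qed.

Lemma in_hypersurface_roles x : (x \in X) =
  ((rc a x * x 0 a) ^+ 2 + (rc b x * x 0 b) ^+ 2 + comonomial c x * x 0 c ^+ e c == 0).
Proof.
rewrite in_hypersurface (sum_ord3 _ blk_ab blk_ac blk_bc).
rewrite (monomial_square x (roles_eva abc) (roles_ea abc)).
rewrite (monomial_square x (roles_evb abc) (roles_eb abc)).
by rewrite monomial_comonomial [_ * comonomial _ _]mulrC.
Qed.

(** The coordinate u = A x_a + iota B x_b. Taking - iota instead gives the
    coordinate v, and the first two monomials add up to u v. *)
Definition isotropic x := rc a x * x 0 a + iota * (rc b x * x 0 b).

Definition flow_speed x := 2%:R * isotropic x * rc a x * rc b x.

(** The flow of a locally nilpotent derivation. The equation reads u v + C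
    x_c^d = 0; the flow fixes u and the variables other than x_a, x_b, x_c,
    translates x_c by a multiple of u A B, and changes v in the only way that
    keeps the equation. The factor A B makes x_a and x_b move polynomially. *)
Definition flow (s : K) (x : 'rV[K]_N) : 'rV[K]_N :=
  let q := difference_quotient (e c) (flow_speed x) s (x 0 c) in
  \row_k (if k == c then x 0 c + s * flow_speed x
          else if k == a then x 0 a - rc b x * comonomial c x * q
          else if k == b then x 0 b - iota * rc a x * comonomial c x * q
          else x 0 k).

Lemma flow_c s x : flow s x 0 c = x 0 c + s * flow_speed x.
Proof. by rewrite mxE eqxx. Qed.

Lemma flow_a s x : flow s x 0 a = x 0 a - rc b x * comonomial c x *
  difference_quotient (e c) (flow_speed x) s (x 0 c).
Proof. by rewrite mxE (negPf ac) eqxx. Qed.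

Lemma flow_b s x : flow s x 0 b = x 0 b - iota * rc a x * comonomial c x *
  difference_quotient (e c) (flow_speed x) s (x 0 c).
Proof. by rewrite mxE (negPf bc) eq_sym (negPf ab) eqxx. Qed.

Lemma flow_other s x k : k != a -> k != b -> k != c -> flow s x 0 k = x 0 k.
Proof. by rewrite mxE => /negPf-> /negPf-> /negPf->. Qed.

Definition same_off_abc (x y : 'rV[K]_N) :=
  forall k, k != a -> k != b -> k != c -> x 0 k = y 0 k.

Lemma same_off_coefficients x y : same_off_abc x y ->
  [/\ rc a x = rc a y, rc b x = rc b y & comonomial c x = comonomial c y].
Proof.
move=> xy; split; apply: eq_bigr => k /andP[/eqP bk kj]; congr (_ ^+ _); apply: xy => //.
- by apply: contraNneq blk_ab => <-; rewrite bk.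
- by apply: contraNneq blk_ac => <-; rewrite bk.
- by apply: contraNneq blk_ab => <-; rewrite bk.
- by apply: contraNneq blk_bc => <-; rewrite bk.
- by apply: contraNneq blk_ac => <-; rewrite bk.
- by apply: contraNneq blk_bc => <-; rewrite bk.
Qed.

Lemma flow_coefficients s x : [/\ rc a (flow s x) = rc a x,
  rc b (flow s x) = rc b x & comonomial c (flow s x) = comonomial c x].
Proof. by apply: same_off_coefficients => k ka kb kc; apply: flow_other. Qed.

Lemma flow_isotropic s x : isotropic (flow s x) = isotropic x.
Proof.
have [rA rB _] := flow_coefficients s x.
rewrite /isotropic rA rB flow_a flow_b.
set q := difference_quotient _ _ _ _; move: (rc a x) (rc b x) (comonomial c x) => A B C.
transitivity (A * x 0 a + iota * (B * x 0 b) - (1 + iota ^+ 2) * (A * B * C * q)).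
  by ring.
by rewrite iota2 addrN mul0r subr0.
Qed.

Lemma flow_speed_flow s x : flow_speed (flow s x) = flow_speed x.
Proof.
have [rA rB _] := flow_coefficients s x.
by rewrite /flow_speed flow_isotropic rA rB.
Qed.

(** The product u v changes by the opposite of the increment of C x_c^d. *)
Lemma flow_hypersurface s x : x \in X -> flow s x \in X.
Proof.
rewrite !in_hypersurface_roles => /eqP xX; rewrite -{}[X in _ == X]xX; apply/eqP.
have [rA rB ->] := flow_coefficients s x; rewrite rA rB.
have factor y z : y ^+ 2 + z ^+ 2 = (y + iota * z) * (y - iota * z).
  transitivity (y ^+ 2 - iota ^+ 2 * z ^+ 2); last by ring.
  by rewrite iota2 mulN1r opprK.
rewrite !factor; have := flow_isotropic s x; rewrite /isotropic rA rB => ->.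
have := difference_quotientE (e c) (flow_speed x) s (x 0 c).
rewrite flow_a flow_b flow_c; set q := difference_quotient _ _ _ _.
move=> qE; have {qE} -> : (x 0 c + s * flow_speed x) ^+ e c
    = x 0 c ^+ e c + flow_speed x * q by rewrite qE [RHS]addrC subrK.
rewrite /flow_speed /isotropic; move: (rc a x) (rc b x) (comonomial c x) => A B C.
have -> : iota * (B * (x 0 b - iota * A * C * q)) =
   iota * (B * x 0 b) - iota ^+ 2 * (A * B * C * q) by ring.
by rewrite iota2; ring.
Qed.

Lemma flow0 x : flow 0 x = x.
Proof.
apply/rowP => k; rewrite mxE /difference_quotient !mul0r !mulr0 !subr0 addr0.
by case: eqP => [->//|_]; case: eqP => [->//|_]; case: eqP => [->//|_].
Qed.

Lemma flowD s t x : flow (s + t) x = flow s (flow t x).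
Proof.
have [rA rB cC] := flow_coefficients t x.
apply/rowP => k; have [->|kc] := eqVneq k c.
  by rewrite !flow_c flow_speed_flow mulrDl [s * _ + _]addrC addrA.
have [->|ka] := eqVneq k a.
  rewrite !flow_a flow_speed_flow flow_c rB cC difference_quotientD.
  by rewrite mulrDr opprD addrA.
have [->|kb] := eqVneq k b; last by rewrite !flow_other.
rewrite !flow_b flow_speed_flow flow_c rA cC difference_quotientD.
by rewrite mulrDr opprD addrA.
Qed.

(** The point of X at which u = 1, v = -1 and all variables other than x_a and
    x_b are 1. *)
Definition base_point : 'rV[K]_N := upd (upd ones a 0) b (- iota).

Lemma base_point_coefficients : [/\ rc a base_point = 1, rc b base_point = 1
  & comonomial c base_point = 1].
Proof.
have [-> -> ->] : [/\ rc a base_point = rc a ones,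
   rc b base_point = rc b ones & comonomial c base_point = comonomial c ones].
  apply: same_off_coefficients => k ka kb kc.
  by rewrite !updE (negPf ka) (negPf kb).
by split; rewrite /rc /comonomial big1 // => k _; rewrite mxE expr1n.
Qed.

Lemma base_point_a : base_point 0 a = 0.
Proof. by rewrite !updE (negPf ab) eqxx. Qed.
Lemma base_point_b : base_point 0 b = - iota.
Proof. by rewrite updE eqxx. Qed.
Lemma base_point_other k : k != a -> k != b -> base_point 0 k = 1.
Proof. by move=> ka kb; rewrite !updE (negPf ka) (negPf kb) mxE. Qed.

Lemma base_point_isotropic : isotropic base_point = 1.
Proof.
have [A B _] := base_point_coefficients.
rewrite /isotropic A B base_point_a base_point_b mul1r mul1r add0r mulrN.
by rewrite -expr2 iota2 opprK.
Qed.

Lemma base_point_in : base_point \in X.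
Proof.
have [A B C] := base_point_coefficients.
rewrite in_hypersurface_roles A B C base_point_a base_point_b base_point_other; last first.
- by rewrite eq_sym.
- by rewrite eq_sym.
by rewrite !mul1r expr1n expr0n add0r sqrrN iota2 addNr.
Qed.

Lemma polyfun_root_comonomial j : polyfun (rc j).
Proof. by apply: polyfun_prod => k _; apply: polyfun_exp; apply: polyfunX. Qed.

Lemma polyfun_comonomial j : polyfun (fun x : 'rV[K]_N => comonomial j x).
Proof. by apply: polyfun_prod => k _; apply: polyfun_exp; apply: polyfunX. Qed.

(** The flow is an action of the additive group; it is faithful because it
    moves x_c at the base point. *)
Lemma flow_same_orbit s x : x \in X -> x ~ flow s x.
Proof.
move=> xX; pose act (t : 'rV[K]_1) := flow (t 0 0).
suff : x ~ act (const_mx s) x by rewrite /act mxE.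
apply: (@connected_action_same_orbit _ _ _ X [::] act (fun t u => t + u)
  (fun t => - t) 0) => //.
- exact: zconnected_additive charK0.
- by move=> t _; rewrite addNr addrN.
- by move=> t y _; apply: flow_hypersurface.
- by move=> y _; rewrite /act mxE flow0.
- by move=> t u y _ _ _; rewrite /act mxE flowD.
- move=> t u _ _ tu; have /rowP/(_ c) := tu _ base_point_in.
  rewrite /act !flow_c => /addrI; rewrite /flow_speed base_point_isotropic.
  have [-> -> _] := base_point_coefficients; rewrite !mulr1 => /mulIf tu0.
  apply/rowP => i; rewrite ord1; apply: tu0.
  exact: natr_neq0.
- have pt : polyfun (fun w : 'rV[K]_(1 + N) => lsubmx w 0 0) by exact: polyfun_lsub.
  have px k : polyfun (fun w : 'rV[K]_(1 + N) => rsubmx w 0 k) by exact: polyfun_rsub.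
  have comp h : polyfun h -> polyfun (fun w : 'rV[K]_(1 + N) => h (rsubmx w)).
    by move=> hp; apply: (@polyfun_comp _ _ _ h rsubmx) => // k; apply: px.
  have pA := comp _ (polyfun_root_comonomial a); have pB := comp _ (polyfun_root_comonomial b).
  have pC := comp _ (polyfun_comonomial c).
  have pu : polyfun (fun w : 'rV[K]_(1 + N) => isotropic (rsubmx w)).
    exact: polyfunD (polyfunM pA (px a)) (polyfunM (polyfunC _ iota) (polyfunM pB (px b))).
  have pw : polyfun (fun w : 'rV[K]_(1 + N) => flow_speed (rsubmx w)).
    exact: polyfunM (polyfunM (polyfunM (polyfunC _ 2%:R) pu) pA) pB.
  have pq : polyfun (fun w : 'rV[K]_(1 + N) => difference_quotient (e c)
      (flow_speed (rsubmx w)) (lsubmx w 0 0) (rsubmx w 0 c)).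
    apply: (polyfunM pt); apply: polyfun_sum => i _.
    apply: (fun h => polyfunM h (polyfun_exp _ (px c))); apply: polyfun_exp.
    exact: polyfunD (px c) (polyfunM pt pw).
  move=> k; have [kc|kc] := boolP (k == c).
    apply: polyfun_ext (polyfunD (px c) (polyfunM pt pw)) => w.
    by rewrite [RHS]mxE kc.
  have [ka|ka] := boolP (k == a).
    apply: polyfun_ext (polyfunD (px a) (polyfunN (polyfunM (polyfunM pB pC) pq))) => w.
    by rewrite [RHS]mxE (negPf kc) ka.
  have [kb|kb] := boolP (k == b).
    apply: polyfun_ext (polyfunD (px b) (polyfunN
      (polyfunM (polyfunM (polyfunM (polyfunC _ iota) pA) pC) pq))) => w.
    by rewrite [RHS]mxE (negPf kc) (negPf ka) kb.
  apply: polyfun_ext (px k) => w.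
  by rewrite [RHS]mxE (negPf kc) (negPf ka) (negPf kb).
- move=> k; apply: polyfun_ext (polyfunD (polyfun_lsub _ _ k) (polyfun_rsub _ _ k)) => w.
  by rewrite [RHS]mxE.
- by move=> k; apply: polyfun_ext (polyfunN (polyfunX _ k)) => w; rewrite [RHS]mxE.
Qed.

(** The speed of x_c is constant along the flow, and nonzero here. *)
Lemma flow_move_c t x : x \in X -> isotropic x != 0 -> rc a x != 0 -> rc b x != 0 ->
  exists y, [/\ x ~ y, y 0 c = t, same_off_abc y x & isotropic y = isotropic x].
Proof.
move=> xX u0 A0 B0; have w0 : flow_speed x != 0.
  by rewrite !mulf_neq0 //; apply: natr_neq0.
exists (flow ((t - x 0 c) / flow_speed x) x); split.
- exact: flow_same_orbit.
- by rewrite flow_c divfK // addrC subrK.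
- by move=> k ka kb kc; rewrite flow_other.
- exact: flow_isotropic.
Qed.

(** Where A = 0 the speed of x_c is zero and x_b does not move either, so that
    x_a moves alone, at constant speed. *)
Lemma flow_move_a t x : x \in X -> rc a x = 0 -> rc b x != 0 -> comonomial c x != 0 ->
  x 0 c != 0 -> x ~ upd x a t.
Proof.
move=> xX A0 B0 C0 xc; pose r := rc b x * comonomial c x * (x 0 c ^+ (e c).-1 *+ e c).
have r0 : r != 0.
  rewrite !mulf_neq0 // -mulr_natr mulf_neq0 ?expf_neq0 //.
  by apply: natr_neq0 => //; apply: ltnW.
have w0 : flow_speed x = 0 by rewrite /flow_speed A0 mulr0 mul0r.
suff <- : flow ((x 0 a - t) / r) x = upd x a t by apply: flow_same_orbit.
apply/rowP => k; rewrite updE; have [->|kc] := eqVneq k c.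
  by rewrite flow_c w0 mulr0 addr0 eq_sym (negPf ac).
have [->|ka] := eqVneq k a.
  rewrite flow_a w0 difference_quotient0.
  rewrite mulrCA -/r divfK // opprB addrC subrK //.
have [->|kb] := eqVneq k b; last by rewrite flow_other.
by rewrite flow_b A0 mulr0 !mul0r subr0.
Qed.

End Coordinates.

(** * Transitivity on the regular points *)

(** Rescaling x_k and compensating by x_j, which is squared, fixes not only the
    monomial but its square root. Keeping the monomial alone would fix A x_a
    only up to sign, and u not at all. *)
Lemma rescale_root (j k : 'I_N) x : even_block (blk j) -> e j = 2 ->
  blk k = blk j -> k != j -> x \in X -> x 0 k != 0 ->
  exists y, [/\ x ~ y, y 0 k = 1, forall h, h != j -> h != k -> y 0 h = x 0 h &
    rc j y * y 0 j = rc j x * x 0 j].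
Proof.
move=> evj ej bkj kj xX xk.
have ek2 : (2 %| e k)%N by rewrite dvdn2 evj.
have g2 : gcdn (e k) (e j) = 2 by rewrite ej; apply/gcdn_idPr.
have [c] := rescale kj bkj (invr_neq0 xk) xX.
rewrite g2 ej divnn /= expr1 divn2 mulVf // => cE xy.
exists (upd (upd x k 1) j (c * x 0 j)); split=> //.
- by rewrite !updE (negPf kj) eqxx.
- by move=> h /negPf hj /negPf hk; rewrite !updE hj hk.
have rcE y : rc j y = y 0 k ^+ (e k)./2 *
    \prod_(h | (blk h == blk j) && (h != j) && (h != k)) y 0 h ^+ (e h)./2.
  by rewrite /rc (bigD1 k) //= bkj eqxx.
rewrite !rcE !updE eqxx (negPf kj) eqxx expr1n mul1r.
rewrite (eq_bigr (fun h => x 0 h ^+ (e h)./2)) => [|h]; last first.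
  by move=> /andP[/andP[_ /negPf hj] /negPf hk]; rewrite !updE hj hk.
have xkE : c = x 0 k ^+ (e k)./2.
  apply: (mulIf (expf_neq0 (e k)./2 (invr_neq0 xk))); rewrite cE.
  by rewrite -exprMn divff // expr1n.
by rewrite {}xkE mulrCA mulrA.
Qed.

Section Roles.
Variables (a b c : 'I_N) (abc : roles a b c).

Definition units_off_ab (x : 'rV[K]_N) :=
  forall k, blk k != blk c -> k != a -> k != b -> x 0 k != 0.

Let blk_ab := roles_ab abc.
Let blk_ac := roles_ac abc.
Let blk_bc := roles_bc abc.

Lemma blk_cases k : [\/ blk k = blk a, blk k = blk b | blk k = blk c].
Proof.
move: blk_ab blk_ac blk_bc; rewrite -!val_eqE /=.
have inj (i i' : 'I_3) : val i = val i' -> i = i' by apply: val_inj.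
move: (blk a) (blk b) (blk c) (blk k) => [[|[|[|i]]] ?] [[|[|[|j]]] ?] [[|[|[|h]]] ?] [[|[|[|m]]] ?] //= _ _ _;
  solve [by apply: Or31; apply: inj | by apply: Or32; apply: inj | by apply: Or33; apply: inj].
Qed.

Lemma units_root_comonomial x : units_off_ab x -> rc a x != 0 /\ rc b x != 0.
Proof.
move=> ux; split; apply/prodf_neq0 => k /andP[/eqP bk kj]; apply/expf_neq0/ux => //;
  rewrite ?bk //.
- by apply: contraNneq blk_ab => <-; rewrite bk.
- by apply: contraNneq blk_ab => <-; rewrite bk.
Qed.

Lemma root_comonomial_eq j (x y : 'rV[K]_N) : (forall k, blk k = blk j -> k != j -> x 0 k = y 0 k) ->
  rc j x = rc j y.
Proof. by move=> xy; apply: eq_bigr => k /andP[/eqP bk kj]; rewrite xy. Qed.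

(** A variable from the first two monomials is rescaled against x_a or x_b, and
    a variable from the third one is moved by the flow; either way u is fixed.
    *)
Lemma set_coordinate iota x k : iota ^+ 2 = -1 -> x \in X -> units_off_ab x ->
  isotropic a b iota x != 0 -> k != a -> k != b ->
  exists y, [/\ x ~ y, y 0 k = 1, forall h, h != a -> h != b -> h != k -> y 0 h = x 0 h &
    isotropic a b iota y = isotropic a b iota x].
Proof.
move=> i2 xX ux u0 ka kb; have [A0 B0] := units_root_comonomial ux.
case: (blk_cases k) => bk.
- have [|y [xy yk yh E]] := rescale_root (roles_eva abc) (roles_ea abc) bk ka xX.
    by apply: ux => //; rewrite bk.
  exists y; split=> //; first by move=> h ha hb hk; apply: yh.
  rewrite /isotropic E (@root_comonomial_eq b y x).
    rewrite yh //; first by apply: contraNneq blk_ab => ->.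
    by rewrite eq_sym.
  move=> h bh hb; apply: yh; first by apply: contraNneq blk_ab => <-; rewrite bh.
  by apply: contraNneq blk_ab => hk; rewrite -bh hk bk.
- have [|y [xy yk yh E]] := rescale_root (roles_evb abc) (roles_eb abc) bk kb xX.
    by apply: ux => //; rewrite bk.
  exists y; split=> //; first by move=> h ha hb hk; apply: yh.
  rewrite /isotropic E (@root_comonomial_eq a y x).
    rewrite yh //; first by apply: contraNneq blk_ab => ->.
    by rewrite eq_sym.
  move=> h bh hb; apply: yh; first by apply: contraNneq blk_ab => <-; rewrite bh.
  by apply: contraNneq blk_ab => hk; rewrite -bh hk bk.
have abk : roles a b k by case: abc => *; split; rewrite // bk.
have [y [xy yk yh E]] := flow_move_c abk i2 1 xX u0 A0 B0.
by exists y; split=> // h ha hb hk; apply: yh.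
Qed.

Lemma set_coordinates iota x : iota ^+ 2 = -1 -> x \in X -> units_off_ab x ->
  isotropic a b iota x != 0 ->
  exists y, [/\ x ~ y, forall k, k != a -> k != b -> y 0 k = 1 &
    isotropic a b iota y = isotropic a b iota x].
Proof.
move=> i2 xX ux u0.
suff [y [xy _ ys E]] : exists y, [/\ x ~ y, units_off_ab y,
    forall k, k \in enum 'I_N -> k != a -> k != b -> y 0 k = 1 &
    isotropic a b iota y = isotropic a b iota x].
  by exists y; split=> // k; apply: ys; rewrite mem_enum.
elim: (enum 'I_N) => [|k s [y [xy uy ys E]]].
  by exists x; split=> //; apply: (same_orbit_refl (exist (fun z => z \in X) x xX)).
have [ab|] := boolP ((k == a) || (k == b)).
  exists y; split=> // h; rewrite inE => /orP[/eqP-> ka kb|]; last exact: ys.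
  by rewrite (negPf ka) (negPf kb) in ab.
rewrite negb_or => /andP[ka kb].
have yX : y \in X by have [] := same_orbit_in xy.
have [|z [yz zk zh F]] := set_coordinate i2 yX uy _ ka kb; first by rewrite E.
exists z; split.
- exact: same_orbit_trans xy yz.
- move=> h bh ha hb; have [->|hk] := eqVneq h k; first by rewrite zk oner_neq0.
  by rewrite zh //; apply: uy.
- move=> h; rewrite inE; have [->|hk] := eqVneq h k; first by rewrite zk.
  by move=> /= hs ha hb; rewrite zh // ys.
- by rewrite F E.
Qed.

Lemma isotropic_mul iota x : iota ^+ 2 = -1 -> x \in X ->
  isotropic a b iota x * isotropic a b (- iota) x = - (comonomial c x * x 0 c ^+ e c).
Proof.
move=> i2; rewrite (in_hypersurface_roles abc) addr_eq0 => /eqP <-.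
rewrite /isotropic; set p := rc a x * x 0 a; set q := rc b x * x 0 b.
transitivity (p ^+ 2 - iota ^+ 2 * q ^+ 2); first by ring.
by rewrite i2 mulN1r opprK.
Qed.

Lemma ones_coefficients (x : 'rV[K]_N) : (forall k, k != a -> k != b -> k != c -> x 0 k = 1) ->
  [/\ rc a x = 1, rc b x = 1 & comonomial c x = 1].
Proof.
move=> x1; have xb : same_off_abc a b c x (base_point a b 0).
  by move=> k ka kb kc; rewrite x1 // base_point_other.
have [-> -> ->] := same_off_coefficients abc xb.
exact: base_point_coefficients.
Qed.

(** With A = B = C = 1 the equation is u v = - x_c^d. Moving x_c from 1 to a
    d-th root of u with u fixed brings v to -1, and moving it back to 1 with v
    fixed brings u to 1. *)
Lemma ones_base_point iota x : iota ^+ 2 = -1 -> x \in X ->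
  (forall k, k != a -> k != b -> x 0 k = 1) -> isotropic a b iota x != 0 ->
  x ~ base_point a b iota.
Proof.
move=> i2 xX x1 u0; have d0 : (0 < e c)%N by apply: ltnW.
have Ni2 : (- iota) ^+ 2 = -1 by rewrite sqrrN.
have ca : c != a by apply: contraNneq blk_ac => ->.
have cb : c != b by apply: contraNneq blk_bc => ->.
have [t tE] := exists_root (isotropic a b iota x) d0.
have [A1 B1 C1] := ones_coefficients (fun k ka kb _ => x1 k ka kb).
have [||y [xy yc yh yu]] := flow_move_c abc i2 t xX u0.
- by rewrite A1 oner_neq0.
- by rewrite B1 oner_neq0.
have yX : y \in X by have [] := same_orbit_in xy.
have y1 k : k != a -> k != b -> k != c -> y 0 k = 1.
  by move=> ka kb kc; rewrite yh // x1.
have [A2 B2 C2] := ones_coefficients y1.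
have v1 : isotropic a b (- iota) y = -1.
  have := isotropic_mul i2 yX; rewrite yu C2 yc tE mul1r => E.
  by apply: (mulfI u0); rewrite mulrN1.
have [|||z [yz zc zh zv]] := flow_move_c abc Ni2 1 yX.
- by rewrite v1 oppr_eq0 oner_neq0.
- by rewrite A2 oner_neq0.
- by rewrite B2 oner_neq0.
suff <- : z = base_point a b iota by apply: same_orbit_trans xy yz.
have zX : z \in X by have [] := same_orbit_in yz.
have z1 k : k != a -> k != b -> k != c -> z 0 k = 1.
  by move=> ka kb kc; rewrite zh // y1.
have [A3 B3 C3] := ones_coefficients z1.
have zu : isotropic a b iota z = 1.
  have := isotropic_mul i2 zX; rewrite zv v1 C3 zc expr1n mulr1 mulrN1.
  exact: oppr_inj.
have zv' : isotropic a b (- iota) z = -1 by rewrite zv.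
move: zu zv'; rewrite /isotropic A3 B3 !mul1r => zu zv'.
have za : z 0 a = 0.
  apply: (mulfI (natr_neq0 (isT : (0 < 2)%N))); rewrite mulr0.
  transitivity ((z 0 a + iota * z 0 b) + (z 0 a + - iota * z 0 b)); first by ring.
  by rewrite zu zv' addrN.
have zb : z 0 b = - iota.
  rewrite -[LHS]mul1r -[1]opprK -i2 expr2 mulNr -mulrA.
  by move: zu; rewrite za add0r => ->; rewrite mulr1.
apply/rowP => k; have [->|ka] := eqVneq k a.
  by rewrite za (base_point_a abc).
have [->|kb] := eqVneq k b; first by rewrite zb base_point_b.
rewrite base_point_other //; have [->|kc] := eqVneq k c; first exact: zc.
exact: z1.
Qed.

Lemma isotropic_base_point iota x : iota ^+ 2 = -1 -> x \in X -> units_off_ab x ->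
  isotropic a b iota x != 0 -> x ~ base_point a b iota.
Proof.
move=> i2 xX ux u0; have [y [xy y1 yu]] := set_coordinates i2 xX ux u0.
apply: (same_orbit_trans xy); apply: ones_base_point => //.
  by have [] := same_orbit_in xy.
by rewrite yu.
Qed.

(** If u vanishes then v does not, and the flow for - iota leads to its own
    base point, where u = -1; the flow for iota takes over from there. *)
Lemma units_base_point iota x : iota ^+ 2 = -1 -> x \in X -> units_off_ab x ->
  (x 0 a != 0) || (x 0 b != 0) -> x ~ base_point a b iota.
Proof.
move=> i2 xX ux xab; have Ni2 : (- iota) ^+ 2 = -1 by rewrite sqrrN.
have [u0|u0] := eqVneq (isotropic a b iota x) 0; last exact: isotropic_base_point.
have [v0|v0] := eqVneq (isotropic a b (- iota) x) 0.
  have [A0 B0] := units_root_comonomial ux.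
  have i0 : iota != 0.
    by apply/eqP => i0; move/eqP: i2; rewrite i0 expr0n eq_sym oppr_eq0 oner_eq0.
  have two := natr_neq0 (isT : (0 < 2)%N).
  have : 2%:R * (rc a x * x 0 a) = 0.
    transitivity (isotropic a b iota x + isotropic a b (- iota) x); last first.
      by rewrite u0 v0 addr0.
    by rewrite /isotropic; ring.
  have : 2%:R * (iota * (rc b x * x 0 b)) = 0.
    transitivity (isotropic a b iota x - isotropic a b (- iota) x); last first.
      by rewrite u0 v0 subr0.
    by rewrite /isotropic; ring.
  move=> /eqP; rewrite !mulf_eq0 (negPf two) (negPf i0) (negPf B0) /= => xb.
  move=> /eqP; rewrite !mulf_eq0 (negPf two) (negPf A0) /= => xa.
  by rewrite xa xb in xab.
have [y [xy y1 yv]] := set_coordinates Ni2 xX ux v0.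
apply: (same_orbit_trans (isotropic_base_point Ni2 xX ux v0)).
have bX := base_point_in abc Ni2.
apply: ones_base_point => //; first by move=> k; apply: base_point_other.
have [A1 B1 _] := base_point_coefficients abc (- iota).
rewrite /isotropic A1 B1 (base_point_a abc) base_point_b opprK !mul1r add0r.
by rewrite -expr2 i2 oppr_eq0 oner_neq0.
Qed.

End Roles.

Lemma monomial_neq0 i (x : 'rV[K]_N) : monomial i x != 0 -> forall k, blk k = i -> x 0 k != 0.
Proof.
move=> /prodf_neq0 H k /eqP /H; rewrite expf_eq0 negb_and -leqNgt leqn0.
by rewrite gtn_eqF // ltnW.
Qed.

Lemma monomial_eq0 i (x : 'rV[K]_N) : monomial i x = 0 -> exists2 k, blk k = i & x 0 k = 0.
Proof.
move/eqP/prodf_eq0 => [k /eqP bk]; rewrite expf_eq0 => /andP[_ /eqP xk].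
by exists k.
Qed.

Lemma roles_generic a b c (o x : 'rV[K]_N) : roles a b c -> o \in X -> (forall k, o 0 k != 0) ->
  x \in X -> units_off_ab a b c x -> (x 0 a != 0) || (x 0 b != 0) -> x ~ o.
Proof.
move=> abc oX o0 xX ux xab; have [iota i2] := exists_root (-1 : K) (isT : (0 < 2)%N).
apply: (same_orbit_trans (units_base_point abc i2 xX ux xab)); apply: same_orbit_sym.
by apply: (units_base_point abc i2) => //; rewrite o0.
Qed.

(** On X the three monomials add up to zero, so that two of them cannot vanish
    without the third. *)
Lemma regular_monomials (x : 'rV[K]_N) : x \in X -> ~ singular x ->
  exists i, forall j, j != i -> monomial j x != 0.
Proof.
move=> xX nsx; apply: NNPP => H; apply: nsx => i.
have zero_off h : exists2 j, j != h & monomial j x = 0.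
  apply: NNPP => H'; apply: H; exists h => j jh; apply/eqP => Mj.
  by apply: H'; exists j.
have [j _ Mj] := zero_off i; have [k kj Mk] := zero_off j.
have [->|ij] := eqVneq i j; first exact: Mj.
have [->|ik] := eqVneq i k; first exact: Mk.
have jk : j != k by rewrite eq_sym.
move: xX; rewrite in_hypersurface (sum_ord3 _ ij ik jk).
by rewrite Mj Mk !addr0 => /eqP.
Qed.

Lemma other_blocks (i : 'I_3) : exists i0 i1, [/\ i0 != i1, i0 != i & i1 != i].
Proof.
exists (i + 1), (i + 2%:R); case: i => -[|[|[|i]]] //.
Qed.

(** The roles are chosen so that x_c is in the only monomial that may vanish.
    *)
Lemma transitive_even_blocks (o x : 'rV[K]_N) : o \in X -> (forall k, o 0 k != 0) ->
  (forall i, even_block i /\ exists2 k, blk k = i & e k = 2) ->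
  x \in X -> ~ singular x -> x ~ o.
Proof.
move=> oX o0 H5 xX nsx; have [i Mi] := regular_monomials xX nsx.
have [i0 [i1 [i01 i0i i1i]]] := other_blocks i.
have [ev0 [a ba ea]] := H5 i0; have [ev1 [b bb eb]] := H5 i1.
have [c bc] := blk_surj i.
have abc : roles a b c by split; rewrite // ?ba ?bb ?bc.
apply: (roles_generic abc) => //.
  by move=> k; rewrite bc => bk _ _; apply: (monomial_neq0 (Mi _ bk)).
by rewrite (monomial_neq0 (Mi _ i0i) ba).
Qed.

Section SquareBlocks.
Variables (i0 i1 i2 : 'I_3).
Hypotheses (i01 : i0 != i1) (i02 : i0 != i2) (i12 : i1 != i2).
Hypothesis e0 : forall k, blk k = i0 -> e k = 2.
Hypothesis e1 : forall k, blk k = i1 -> e k = 2.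
Variable o : 'rV[K]_N.
Hypotheses (oX : o \in X) (o0 : forall k, o 0 k != 0).

Lemma square_roles a b c : blk a = i0 -> blk b = i1 -> blk c = i2 -> roles a b c.
Proof.
move=> ba bb bc; split; rewrite ?ba ?bb ?bc //.
- exact: e0.
- exact: e1.
- by move=> k /e0->.
- by move=> k /e1->.
Qed.

Lemma square_blocks_cases k : [\/ blk k = i0, blk k = i1 | blk k = i2].
Proof.
have [a ba] := blk_surj i0; have [b bb] := blk_surj i1; have [c bc] := blk_surj i2.
by have := blk_cases (square_roles ba bb bc) k; rewrite ba bb bc.
Qed.

(** As long as two variables x_a and x_a' of the first monomial vanish, the
    flow moves x_a alone away from zero. Once at most one variable x_a of that
    monomial vanishes, it can be given its role in a flow, since every exponent
    there is 2. *)
Lemma transitive_square_blocks x : x \in X ->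
  monomial i1 x != 0 -> monomial i2 x != 0 -> x ~ o.
Proof.
have [m] := ubnP #|[set k | (blk k == i0) && (x 0 k == 0)]|.
elim: m x => // m IHm x; rewrite ltnS => xm xX M1 M2.
have x1 := monomial_neq0 M1; have x2 := monomial_neq0 M2.
have [b bb] := blk_surj i1; have [c bc] := blk_surj i2.
case: (classic (exists2 a, blk a = i0 & x 0 a = 0)) => [[a ba xa]|H]; last first.
  have [a ba] := blk_surj i0; apply: (roles_generic (square_roles ba bb bc)) => //.
    move=> k; rewrite bc; case: (square_blocks_cases k) => bk _ _ _.
    - by apply/eqP => xk; apply: H; exists k.
    - exact: x1.
    - exact: x2.
  by rewrite (x1 b) // orbT.
have abc := square_roles ba bb bc.
case: (classic (exists2 a', blk a' = i0 /\ a' != a & x 0 a' = 0)) => [[a' [ba' aa'] xa']|H].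
  have rcb : rc b x != 0.
    apply/prodf_neq0 => k /andP[/eqP bk _]; apply: expf_neq0; apply: x1.
    by rewrite bk.
  have cc : comonomial c x != 0.
    apply/prodf_neq0 => k /andP[/eqP bk _]; apply: expf_neq0; apply: x2.
    by rewrite bk.
  have rca : rc a x = 0.
    by rewrite /rc (bigD1 a') ?ba ?ba' ?eqxx //= xa' e0 // expr1 mul0r.
  have xy : x ~ upd x a 1.
    have [iota j2] := exists_root (-1 : K) (isT : (0 < 2)%N).
    exact: (flow_move_a abc j2 1 xX rca rcb cc (x2 _ bc)).
  apply: (same_orbit_trans xy); apply: IHm.
  - apply: leq_trans xm; apply: proper_card; apply/properP; split.
      apply/subsetP => k; rewrite !inE updE; case: (k == a) => //.
      by rewrite oner_eq0 andbF.
    by exists a; rewrite !inE ?updE ?eqxx ?ba ?eqxx ?xa ?eqxx // oner_eq0.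
  - by have [] := same_orbit_in xy.
  - by rewrite monomial_upd // ba eq_sym.
  - by rewrite monomial_upd // ba eq_sym.
apply: (roles_generic abc) => //; last by rewrite (x1 b) // orbT.
move=> k; rewrite bc; case: (square_blocks_cases k) => bk _ ka _.
- by apply/eqP => xk; apply: H; exists k.
- exact: x1.
- exact: x2.
Qed.

End SquareBlocks.

(** The first case is type H_5; the second one is type H_2, the exponents of
    the third monomial being left free. *)
Definition H2_or_H5_exponents :=
  (forall i, even_block i /\ exists2 k, blk k = i & e k = 2) \/
  (exists i0 i1, i0 != i1 /\ forall k, blk k = i0 \/ blk k = i1 -> e k = 2).

Lemma regular_same_orbit (x y : 'rV[K]_N) : H2_or_H5_exponents ->
  x \in X -> ~ singular x -> y \in X -> ~ singular y -> x ~ y.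
Proof.
move=> HX; have [o oX o0] := generic_point.
suff reach z : z \in X -> ~ singular z -> z ~ o.
  move=> xX nsx yX nsy; apply: (same_orbit_trans (reach x xX nsx)).
  by apply: same_orbit_sym; apply: reach.
move=> zX nsz; case: HX => [H5|[i0 [i1 [i01 H2]]]].
  exact: transitive_even_blocks.
have e0 k : blk k = i0 -> e k = 2 by move=> bk; apply: H2; left.
have e1 k : blk k = i1 -> e k = 2 by move=> bk; apply: H2; right.
have [i2 [i02 i12]] : exists i2, i0 != i2 /\ i1 != i2.
  exists (- (i0 + i1)); move: i01; rewrite -!val_eqE.
  by move: i0 i1 {H2 e0 e1} => [[|[|[|?]]] ?] [[|[|[|?]]] ?].
have [i Mi] := regular_monomials zX nsz.
have [a ba] := blk_surj i0; have [b bb] := blk_surj i1; have [c bc] := blk_surj i2.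
have i20 : i2 != i0 by rewrite eq_sym.
have i21 : i2 != i1 by rewrite eq_sym.
have i10 : i1 != i0 by rewrite eq_sym.
have [ii0|ni0] := eqVneq i i0.
  subst i; apply: (transitive_square_blocks i01 i02 i12) => //; exact: Mi.
have [ii1|ni1] := eqVneq i i1.
  subst i; apply: (transitive_square_blocks i10 i12 i02) => //; exact: Mi.
have abc := square_roles i01 i02 i12 e0 e1 ba bb bc.
have M0 : monomial i0 z != 0 by apply: Mi; rewrite eq_sym.
have M1 : monomial i1 z != 0 by apply: Mi; rewrite eq_sym.
apply: (roles_generic abc) => //; last by rewrite (monomial_neq0 M0).
move=> k; rewrite bc => bk _ _.
case: (square_blocks_cases i01 i02 i12 e0 e1 k) => bk'.
- exact: (monomial_neq0 M0).
- exact: (monomial_neq0 M1).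
- by rewrite bk' eqxx in bk.
Qed.

(** * Components of the singular locus *)

Implicit Types (x y : 'rV[K]_N) (f g : pts X -> pts X) (z : 'I_3 -> 'I_N).

Lemma singular_in x : singular x -> x \in X.
Proof. by move=> sx; rewrite in_hypersurface big1. Qed.

Lemma is_aut_singular f (x : pts X) : is_aut f -> singular (val x) -> singular (val (f x)).
Proof.
move=> fA sx; apply: NNPP => nsfx; have [_ [g [gm fK gK]]] := fA.
have := (regularP (f x)).2 nsfx.
move=> /(is_aut_regular (is_aut_inv fA fK gK)); rewrite fK.
by move/(regularP).
Qed.

(** The irreducible components of the singular locus are the coordinate
    subspaces x_(z 0) = x_(z 1) = x_(z 2) = 0, with one variable z i from each
    monomial. *)
Definition transversal z := forall i, blk (z i) = i.

Definition component z x := forall i, x 0 (z i) = 0.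

(** The projection onto a component, which parametrizes it by the affine space.
    *)
Definition kill z x : 'rV[K]_N := \row_k if k == z (blk k) then 0 else x 0 k.

Lemma killE z x k : kill z x 0 k = if k == z (blk k) then 0 else x 0 k.
Proof. by rewrite mxE. Qed.

Lemma component_kill z x : transversal z -> component z (kill z x).
Proof. by move=> zT i; rewrite killE zT eqxx. Qed.

Lemma kill_id z x : component z x -> kill z x = x.
Proof.
by move=> zx; apply/rowP => k; rewrite killE; case: eqP => // ->; rewrite zx.
Qed.

Lemma polymap_kill z : polymap (kill z).
Proof.
move=> k; have [kz|kz] := boolP (k == z (blk k)).
  by apply: polyfun_ext (polyfunC _ 0) => x; rewrite killE kz.
by apply: polyfun_ext (polyfunX _ k) => x; rewrite killE (negPf kz).
Qed.

Lemma monomial_eq0_at k x : x 0 k = 0 -> monomial (blk k) x = 0.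
Proof.
by move=> xk; rewrite monomial_comonomial xk expr0n gtn_eqF ?mul0r // ltnW.
Qed.

Lemma component_singular z x : transversal z -> component z x -> singular x.
Proof. by move=> zT zx i; rewrite -(zT i); apply: monomial_eq0_at. Qed.

Lemma singular_component k x : singular x -> x 0 k = 0 ->
  exists z, [/\ transversal z, component z x & z (blk k) = k].
Proof.
move=> sx xk; have /fin_all_exists[z zP] i : exists h, blk h = i /\ x 0 h = 0.
  by have [h] := monomial_eq0 (sx i); exists h.
exists (fun i => if i == blk k then k else z i); split; last by rewrite eqxx.
  by move=> i; case: eqP => [->//|_]; case: (zP i).
by move=> i; case: eqP => // _; case: (zP i).
Qed.

(** A point that lies on one component only. *)
Definition generic_singular z := kill z ones.

Lemma component_generic z z' : transversal z' ->
  component z' (generic_singular z) -> z' =1 z.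
Proof.
move=> zT' H i; have := H i; rewrite killE zT'; case: eqP => // _.
by rewrite mxE => /eqP; rewrite oner_eq0.
Qed.

Definition generic_singular_pt z (zT : transversal z) : pts X :=
  exist (fun y => y \in X) (generic_singular z)
    (singular_in (component_singular zT (component_kill ones zT))).

(** The image of a component lies in the singular locus, so that the product of
    the variables of a monomial vanishes along it; as the component is
    irreducible, one of these variables vanishes along it. *)
Lemma is_aut_component f z : is_aut f -> transversal z ->
  exists2 z', transversal z' &
    forall x : pts X, component z (val x) -> component z' (val (f x)).
Proof.
move=> fA zT; have [[F FE] _] := fA.
have /fin_all_exists[G GE] k : exists p : {mpoly K[N]},
    forall x, peval (F k) (kill z x) = peval p x.
  by apply: polyfun_comp (polymap_kill z); exists (F k).
have killX x : kill z x \in X.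
  by apply: singular_in; apply: component_singular zT (component_kill x zT).
have GfE k x : peval (G k) x
    = val (f (exist (fun y => y \in X) (kill z x) (killX x))) 0 k.
  by rewrite FE mxE GE.
have /fin_all_exists[z' z'P] i : exists k, blk k = i /\ G k = 0.
  suff : \prod_(k | blk k == i) G k ^+ e k == 0.
    by case/prodf_eq0 => k /eqP bk; rewrite expf_eq0 => /andP[_ /eqP Gk]; exists k.
  apply/eqP/(peval_eq0 charK0) => x.
  set w := f (exist (fun y => y \in X) (kill z x) (killX x)).
  have sw : singular (val w).
    by apply: is_aut_singular => //=; apply: component_singular zT (component_kill x zT).
  rewrite -(sw i) /peval rmorph_prod; apply: eq_bigr => k _.
  by rewrite rmorphXn /= -/(peval _ _) GfE.
exists z' => [i|x zx i]; first by case: (z'P i).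
have [_ Gz] := z'P i; have := GfE (z' i) (val x).
rewrite Gz /peval meval0 => ->; congr (val (f _) 0 _).
by apply: val_inj; rewrite /= kill_id.
Qed.

(** Automorphisms permute the components, hence the image of a point lying on
    one component only lies on one component only. *)
Lemma is_aut_generic f z (zT : transversal z) : is_aut f ->
  exists z', [/\ transversal z', component z' (val (f (generic_singular_pt zT))),
    forall x : pts X, component z (val x) -> component z' (val (f x)) &
    forall k, val (f (generic_singular_pt zT)) 0 k = 0 -> k = z' (blk k)].
Proof.
move=> fA; have [z' zT' fz] := is_aut_component fA zT.
have zp : component z (val (generic_singular_pt zT)) by apply: component_kill.
exists z'; split=> //; first exact: fz.
move=> k yk; have [_ [g [_ fK gK]]] := fA; have gA := is_aut_inv fA fK gK.
set y := f _ in yk; have sy : singular (val y).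
  by apply: is_aut_singular => //; apply: component_singular zp.
have [z'' [zT'' zy'' zk]] := singular_component sy yk.
have [w wT gw] := is_aut_component gA zT''.
have wz : w =1 z.
  by apply: component_generic => //; have := gw y zy''; rewrite /y fK.
have zp'' : component z'' (val (generic_singular_pt zT'')) by apply: component_kill.
have /(component_generic zT') -> // : component z' (generic_singular z'').
have := fz (g (generic_singular_pt zT'')) _; rewrite gK; apply.
by move=> i; rewrite -wz; apply: gw.
Qed.

(** As s runs through a connected group, exactly one variable of the monomial i
    vanishes at the image of the generic point under s. That this variable is z
    i, or that it is another one, are two disjoint closed conditions on s, and
    the first one holds at the identity. *)
Lemma connected_generic G f z (zT : transversal z) : connected_algebraic_subgroup G -> G f ->
  component z (val (f (generic_singular_pt zT))).
Proof.
move=> [[GA G1 _ _] [m [ps [rho [mul [inv [conn [GE rho_inj] _ _ [F FE]]]]]]]] Gf i.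
set p := generic_singular_pt zT.
have rhoA s : is_aut (rho s) by apply: GA; apply/GE; exists s.
have /fin_all_exists[P PE] k : exists q : {mpoly K[m]},
    forall s, peval (F k) (row_mx s (val p)) = peval q s.
  apply: (@polyfun_comp _ _ _ _ (fun s : 'rV[K]_m => row_mx s (val p))); first by exists (F k).
  exact: polymap_row_mx (@polymap_id _ _) (@polymap_cst _ _ _ _).
have PrhoE k s : peval (P k) (val s) = val (rho s p) 0 k by rewrite FE mxE PE.
pose Q := \prod_(k | (blk k == i) && (k != z i)) P k.
have QE s : peval Q (val s) = \prod_(k | (blk k == i) && (k != z i)) val (rho s p) 0 k.
  by rewrite /Q /peval rmorph_prod; apply: eq_bigr => k _; rewrite -PrhoE.
have [_ /(_ [:: P (z i)] [:: Q])] := conn; case.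
- move=> s sS; rewrite !inE /= !andbT.
  have [zT' [zTT' zy _ _]] := is_aut_generic zT (rhoA (exist _ s sS)).
  have [zz|zz] := eqVneq (zT' i) (z i).
    by left; rewrite (PrhoE _ (exist _ s sS)) -zz zy.
  right; rewrite (QE (exist _ s sS)); apply/eqP.
  by rewrite (bigD1 (zT' i)) /= ?zy ?mul0r // zTT' eqxx.
- move=> s sS; rewrite !inE /= !andbT (PrhoE _ (exist _ s sS)) (QE (exist _ s sS)).
  have [z' [zT' zy _ zu]] := is_aut_generic zT (rhoA (exist _ s sS)).
  move=> [/eqP /zu zi /prodf_eq0[k /andP[/eqP bk kz] /eqP /zu kE]].
  by move: kz; rewrite kE bk zi zT eqxx.
- have [s sf] := (GE f).1 Gf.
  move=> /(_ (val s) (valP s)); rewrite !inE /= andbT PrhoE sf => /eqP //.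
- have [s s1] := (GE id).1 G1.
  move=> /(_ (val s) (valP s)); rewrite !inE /= andbT QE s1 => /prodf_eq0[k /andP[/eqP bk kz]].
  by rewrite /= killE bk (negPf kz) mxE oner_eq0.
Qed.

(** An automorphism maps each component into the one that contains the image of
    its generic point, hence into itself. *)
Lemma connected_zeros G f (x : pts X) k : connected_algebraic_subgroup G -> G f ->
  singular (val x) -> val x 0 k = 0 -> val (f x) 0 k = 0.
Proof.
move=> Gc Gf sx xk; have [z [zT zx zk]] := singular_component sx xk.
have fA : is_aut f by have [[GA _ _ _] _] := Gc; apply: GA.
have [z' [zT' zy fz zu]] := is_aut_generic zT fA.
have zz' i : z i = z' i.
  by have := zu _ (connected_generic zT Gc Gf i); rewrite zT.
by rewrite -zk zz'; apply: fz.
Qed.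

(** The vanishing coordinates of a singular point are determined by the
    components through that point. *)
Lemma Aut_alg_zeros f (x : pts X) : Aut_alg f -> singular (val x) ->
  forall k, (val (f x) 0 k == 0) = (val x 0 k == 0).
Proof.
pose H h := is_aut h /\ forall y : pts X, singular (val y) ->
  forall k, (val (h y) 0 k == 0) = (val y 0 k == 0).
move=> Af sx; have [_] : H f; last by apply.
apply: Af.
  split=> [h []//||h h' [hA hH] [hA' hH']|h h' [hA hH] hK h'K].
  - by split=> //; apply: is_aut_id.
  - split=> [|y sy k]; first exact: is_aut_comp.
    by rewrite /= hH ?hH' //; apply: is_aut_singular.
  - have hA' := is_aut_inv hA hK h'K; split=> // y sy k.
    by rewrite -hH ?h'K //; apply: is_aut_singular.
move=> G Gc h Gh; have [[GA _ _ GV] _] := Gc; have hA := GA h Gh.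
split=> // y sy k; apply/eqP/eqP => yk; last exact: connected_zeros Gc Gh sy yk.
have [_ [g [_ hK gK]]] := hA; rewrite -[y]hK.
by apply: connected_zeros Gc (GV h g Gh hK gK) _ yk; apply: is_aut_singular.
Qed.

(** * Torus orbits of singular points *)

(** At a singular point every monomial contains a vanishing coordinate, which
    absorbs the rescaling of the other ones. *)
Lemma singular_rescale x k t : singular x -> t != 0 -> x 0 k != 0 ->
  x ~ upd x k (t * x 0 k).
Proof.
move=> sx t0 xk; have [j bj xj] := monomial_eq0 (sx (blk k)).
have kj : k != j by apply: contraNneq xk => ->; rewrite xj.
have [c _] := rescale kj (esym bj) t0 (singular_in sx).
rewrite xj mulr0; congr (same_orbit _ _ _); apply/rowP => h; rewrite !updE.
by have [->|//] := eqVneq h j; rewrite eq_sym (negPf kj) xj.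
Qed.

Definition same_zeros x y := forall k, (y 0 k == 0) = (x 0 k == 0).

Lemma same_zeros_singular x y : same_zeros x y -> singular x -> singular y.
Proof.
move=> xy sx i; have [k <- xk] := monomial_eq0 (sx i).
by apply: monomial_eq0_at; apply/eqP; rewrite xy xk.
Qed.

Lemma same_zeros_same_orbit x y : singular x -> same_zeros x y -> x ~ y.
Proof.
move=> sx xy.
suff [w [xw _ wy]] : exists w, [/\ x ~ w, same_zeros x w &
    forall k, k \in enum 'I_N -> w 0 k = y 0 k].
  by have <- : w = y by apply/rowP => k; rewrite wy // mem_enum.
elim: (enum 'I_N) => [|k s [w [xw zw ws]]].
  by exists x; split=> //; apply: (same_orbit_refl (exist (fun y => y \in X) x (singular_in sx))).
have [wk|wk] := eqVneq (w 0 k) 0.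
  exists w; split=> // h; rewrite inE => /orP[/eqP->|]; last exact: ws.
  by rewrite wk; apply/esym/eqP; rewrite xy -zw wk.
have yk : y 0 k != 0 by rewrite xy -zw.
exists (upd w k (y 0 k)); split.
- apply: (same_orbit_trans xw); rewrite -[y 0 k](divfK wk).
  apply: singular_rescale => //; last by rewrite mulf_neq0 ?invr_neq0.
  exact: same_zeros_singular sx.
- by move=> h; rewrite updE; have [->|_] := eqVneq h k; [exact: xy | exact: zw].
- move=> h; rewrite inE updE; have [->|hk] := eqVneq h k => //=.
  exact: ws.
Qed.

Lemma peval_torus_act_poly (t x : 'rV[K]_N) (p : {mpoly K[N]}) :
  peval (torus_act_poly t p) x = peval p (torus_act t x).
Proof.
rewrite /peval /torus_act_poly comp_mpoly_meval; apply: meval_eq => i.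
by rewrite tnth_mktuple mevalZ mevalXU mxE.
Qed.

Lemma torus_act_poly_monomial (t : 'rV[K]_N) i :
  torus_act_poly t (monomial_poly i) = monomial i t *: monomial_poly i.
Proof.
rewrite /torus_act_poly /monomial_poly rmorph_prod /= -scaler_prod.
apply: eq_bigr => k _.
by rewrite rmorphXn /= comp_mpolyXU -tnth_nth tnth_mktuple exprZn.
Qed.

Lemma stabilizer_trinomial (t : 'rV[K]_N) : in_torus t -> (forall i, monomial i t = 1) ->
  line_stabilizer trinomial_poly t.
Proof.
move=> tT t1; split=> //; exists 1; first exact: oner_neq0.
rewrite scale1r /trinomial_poly {1}/torus_act_poly rmorph_sum; apply: eq_bigr => i _.
by apply: etrans (torus_act_poly_monomial t i) _; rewrite t1 scale1r.
Qed.

Lemma stabilizer_act (t x : 'rV[K]_N) : line_stabilizer trinomial_poly t ->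
  x \in X -> torus_act t x \in X.
Proof.
move=> [_ [c c0 tE]]; rewrite !inE /= !andbT -peval_torus_act_poly tE => /eqP xX.
by rewrite /peval mevalZ -/(peval _ _) xX mulr0.
Qed.

(** A rational curve joins 1 to t inside the stabilizer: the coordinates
    outside the vanishing set of x move along lines, raised to a power that
    makes it possible to compensate on one vanishing coordinate z i of each
    monomial, and the other coordinates stay equal to 1. *)
Lemma same_zeros_torus x y : singular x -> same_zeros x y ->
  exists2 t, neutral_component (line_stabilizer trinomial_poly) t &
    torus_act t x = y.
Proof.
move=> sx xy.
have /fin_all_exists[z zP] i : exists k, blk k = i /\ x 0 k = 0.
  by have [k bk xk] := monomial_eq0 (sx i); exists k.
pose U := [pred k | x 0 k != 0].
(* The parameter 0 gives the unit element and the parameter 1 gives t. *)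
have Uz i : ~~ U (z i) by rewrite /= negbK (zP i).2.
have /fin_all_exists[r rE] k : exists r, r ^+ e (z (blk k)) = if U k then y 0 k / x 0 k else 1.
  by apply: exists_root; apply: ltnW.
have r0 k : r k != 0.
  apply/eqP => rk; have := rE k; rewrite rk expr0n gtn_eqF ?(ltnW (e_ge2 _)) //=.
  case: ifP => [/= xk|_] /eqP; rewrite eq_sym ?oner_eq0 // mulf_eq0 invr_eq0 xy.
  by rewrite (negPf xk).
pose R k : {poly K} := 1 + (r k - 1) *: 'X.
have R0 k : (R k).[0] = 1 by rewrite /R hornerD hornerC hornerZ hornerX mulr0 addr0.
have R1 k : (R k).[1] = r k by rewrite /R hornerD hornerC hornerZ hornerX mulr1 addrC subrK.
pose D := \prod_(k | U k) R k.
have D0 : D.[0] = 1 by rewrite horner_prod big1.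
have D1 : D.[1] != 0.
  by rewrite horner_prod; apply/prodf_neq0 => k _; rewrite R1.
have DR t k : D.[t] != 0 -> U k -> (R k).[t] != 0.
  by move=> + Uk; rewrite horner_prod => /prodf_neq0; apply.
pose gam t : 'rV[K]_N := \row_k
  if U k then (R k).[t] ^+ e (z (blk k)) else
  if k == z (blk k) then \prod_(h | (blk h == blk k) && U h) (R h).[t]^-1 ^+ e h else 1.
have gam_torus t : D.[t] != 0 -> in_torus (gam t).
  move=> Dt k; rewrite mxE; case: ifP => [Uk|_]; first by rewrite expf_neq0 // DR.
  case: ifP => _; last exact: oner_neq0.
  by apply/prodf_neq0 => h /andP[_ Uh]; rewrite expf_neq0 // invr_neq0 // DR.
have gam_monomial t i : D.[t] != 0 -> monomial i (gam t) = 1.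
  move=> Dt; have bz := (zP i).1.
  rewrite -bz monomial_comonomial mxE (negPf (Uz i)) bz eqxx /comonomial bz.
  rewrite [X in _ * X](bigID U) /= [X in _ * (_ * X)]big1 ?mulr1 => [|k /andP[/andP[/eqP bk kz] Uk]].
    rewrite [X in _ * X](eq_bigl (fun h => (blk h == i) && U h)) => [|h]; last first.
      rewrite /= -andbA; congr (_ && _); have [->|//] := eqVneq h (z i).
      by rewrite (zP i).2 eqxx.
    rewrite -prodrXl -big_split big1 //= => h /andP[/eqP bh Uh].
    rewrite mxE ifT // bh -!exprM [(e (z i) * _)%N]mulnC -exprMn mulVf ?expr1n //.
    exact: DR.
  by rewrite mxE ifN // bk (negPf kz) expr1n.
have gam0 : gam 0 = const_mx 1.
  apply/rowP => k; rewrite !mxE; case: ifP => _; first by rewrite R0 expr1n.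
  by case: ifP => // _; rewrite big1 // => h _; rewrite R0 invr1 expr1n.
exists (gam 1); last first.
  apply/rowP => k; rewrite !mxE; have [Uk|nUk] := boolP (U k).
    by rewrite R1 rE Uk divfK.
  rewrite /= negbK in nUk; rewrite (eqP nUk) mulr0.
  by apply/esym/eqP; rewrite xy.
exists (fun u => exists2 t, D.[t] != 0 & u = gam t); split.
- by move=> u [t Dt ->]; apply: stabilizer_trinomial; [apply: gam_torus | move=> i; apply: gam_monomial].
- apply: rational_curve_zconnected => //.
    by apply/eqP => DE; move: D1; rewrite DE horner0 eqxx.
  move=> k; have [Uk|nUk] := boolP (U k).
    have [P [m PE]] := ratfun_exp (e (z (blk k))) (ratfun_poly D (R k)).
    by exists P, m => t Dt; rewrite -PE // mxE Uk.
  have [kz|kz] := boolP (k == z (blk k)); last first.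
    have [P [m PE]] := ratfun_cst D 1.
    by exists P, m => t Dt; rewrite -PE // mxE (negPf nUk) (negPf kz).
  have Rinv h : U h -> ratfun D (fun t => (R h).[t]^-1).
    move=> Uh; exists (\prod_(h' | U h' && (h' != h)) R h'), 1%N => t Dt.
    rewrite expr1 /D (bigD1 h) //= hornerM mulrAC divff ?mul1r //.
    exact: DR.
  have [P [m PE]] : ratfun D (fun t => \prod_(h | (blk h == blk k) && U h) (R h).[t]^-1 ^+ e h).
    by apply: ratfun_prod => h /andP[_ Uh]; apply: ratfun_exp; apply: Rinv.
  by exists P, m => t Dt; rewrite -PE // mxE (negPf nUk) kz.
- by exists 0; rewrite ?gam0 // D0 oner_neq0.
- by exists 1.
Qed.

Lemma torus_same_zeros (t x : 'rV[K]_N) : in_torus t -> same_zeros x (torus_act t x).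
Proof. by move=> tT k; rewrite mxE mulf_eq0 (negPf (tT k)). Qed.

(** * The two orbit statements *)

Hypothesis HX : H2_or_H5_exponents.

Lemma regular_orbit : is_orbit (@Aut_alg K N X) (@regular_point K N N.-1 X).
Proof.
have [o oX o0] := generic_point.
pose o' : pts X := exist (fun y => y \in X) o oX.
have nso : ~ singular (val o').
  by move=> /(_ 0) /monomial_eq0[k _ /eqP]; rewrite (negPf (o0 k)).
exists o' => y; split=> [/regularP nsy|[f fA <-]].
  by apply/same_orbitP; apply: regular_same_orbit => //; apply: valP.
by apply: is_aut_regular (Aut_alg_aut fA) _; apply/regularP.
Qed.

Lemma singular_orbit (O : pts X -> Prop) : is_orbit (@Aut_alg K N X) O ->
  (forall x : pts X, O x -> ~ regular_point N.-1 x) ->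
  is_orbit (@torus_maps K N (neutral_component (line_stabilizer trinomial_poly)) X) O.
Proof.
move=> [x OE] nreg; exists x => y; rewrite OE.
have sx : singular (val x).
  apply: NNPP => /regularP; apply: nreg; rewrite OE; exists id => //.
  exact: Aut_alg_id.
split=> [[f fA <-]|[f [t [C [CH Cc C1 Ct]] fE] <-]].
  have [t tT tE] := same_zeros_torus sx
     (Aut_alg_zeros fA sx).
  have tH : line_stabilizer trinomial_poly t by case: tT => C [CH _ _ /CH].
  exists (fun y : pts X => exist (fun y => y \in X) _ (stabilizer_act tH (valP y))).
    by exists t.
  exact: val_inj.
apply/same_orbitP; apply: same_zeros_same_orbit => //.
by rewrite fE; apply: torus_same_zeros; case: (CH _ Ct).
Qed.

End TrinomialHypersurface.

(** * Exponents of the types H_2 and H_5 *)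

Section Types.
Variables (n : 'I_3 -> nat) (l : forall i, (n i).-tuple nat).

Definition block_of (k : 'I_(\sum_i n i)%N) : 'I_3 := tag (tagnat.sig k).

Definition exponent_of (k : 'I_(\sum_i n i)%N) : nat :=
  tnth (l (tag (tagnat.sig k))) (tagged (tagnat.sig k)).

Lemma trinomialE (K : closedFieldType) : trinomial K l = trinomial_poly K block_of exponent_of.
Proof.
apply: eq_bigr => i _; rewrite /monomial_poly.
rewrite (reindex (@tagnat.rank _ n)) /=; last first.
  by exists tagnat.sig => p _; [exact: tagnat.rankK | exact: tagnat.sigK].
rewrite (eq_bigl (fun p : {i & 'I_(n i)} => (tag p == i) && true)); last first.
  by move=> p; rewrite /block_of tagnat.rankK andbT.
rewrite (eq_bigr (fun p : {i & 'I_(n i)} =>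
  'X_(tagnat.Rank (tag p) (tagged p)) ^+ tnth (l (tag p)) (tagged p))); last first.
  by move=> p _; rewrite /exponent_of tagnat.rankK tagnat.rankE.
rewrite -(sig_big_dep (pred1 i) (fun _ _ => true)
  (fun i (j : 'I_(n i)) => 'X_(tagnat.Rank i j) ^+ tnth (l i) j)) /=.
by rewrite big_pred1_eq.
Qed.

Lemma exponent_in k : exponent_of k \in (l (block_of k) : seq nat).
Proof. exact: mem_tnth. Qed.

Lemma in_exponent i v : v \in (l i : seq nat) ->
  exists k, block_of k = i /\ exponent_of k = v.
Proof.
move=> /tnthP[j ->]; exists (tagnat.Rank i j).
by rewrite /block_of /exponent_of /tagnat.Rank tagnat.rankK.
Qed.

Lemma two_evens_mem (s : seq nat) : two_evens s ->
  2%N \in s /\ forall v, v \in s -> ~~ odd v && (1 < v)%N.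
Proof.
move=> [m /allP m0 ->]; rewrite inE eqxx; split=> // v; rewrite inE => /orP[/eqP->//|].
move=> /mapP[w /m0 w0 ->]; rewrite mul2n odd_double /=.
by case: w w0.
Qed.

Lemma two_evens_nseq k : two_evens (nseq k.+1 2%N).
Proof.
exists (nseq k 1%N); first by apply/allP => v /nseqP[->].
by rewrite map_nseq.
Qed.

Hypothesis l_gt0 : forall i j, (0 < tnth (l i) j)%N.
Hypothesis typeX : type_H5 (fun i => l i) \/ (type_H2 (fun i => l i) /\ ~ type_H4 (fun i => l i)).

(** In type H_2, an exponent 1 in the third monomial would give type H_4. *)
Lemma type_exponents : [/\ forall k, (1 < exponent_of k)%N,
  forall i, exists k, block_of k = i & H2_or_H5_exponents block_of exponent_of].
Proof.
case: typeX => [[l' [s sl] H]|[[l' [s sl] [[k0 l0] [k1 l1] l2]] nH4]].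
  have memE i v : (v \in (l i : seq nat)) = (v \in l' ((s^-1)%g i)).
    by rewrite -(perm_mem (sl _)) permKV.
  have lE i : 2%N \in (l i : seq nat) /\ forall v, v \in (l i : seq nat) -> ~~ odd v && (1 < v)%N.
    rewrite memE; have [h2 hv] := two_evens_mem (H ((s^-1)%g i)).
    by split=> // v; rewrite memE; apply: hv.
  have two i : exists2 k, block_of k = i & exponent_of k = 2.
    by have [k [bk ek]] := in_exponent (lE i).1; exists k.
  split.
  - by move=> k; have /andP[] := (lE _).2 _ (exponent_in k).
  - by move=> i; have [k bk _] := two i; exists k.
  - left=> i; split; last exact: two.
    by move=> k _; have /andP[] := (lE _).2 _ (exponent_in k).
have e0 k : block_of k = s 0 -> exponent_of k = 2.
  move=> bk; have := exponent_in k; rewrite bk (perm_mem (sl 0)) l0.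
  by move=> /nseqP[].
have e1 k : block_of k = s 1 -> exponent_of k = 2.
  move=> bk; have := exponent_in k; rewrite bk (perm_mem (sl 1)) l1.
  by move=> /nseqP[].
have s_cases i : [\/ i = s 0, i = s 1 | i = s 2%:R].
  rewrite -[i](permKV s); case: ((s^-1)%g i) => -[|[|[|j]]] // h;
    [apply: Or31 | apply: Or32 | apply: Or33]; congr (s _); exact: val_inj.
have e2 k : block_of k = s 2%:R -> (1 < exponent_of k)%N.
  move=> bk; have ek0 : (0 < exponent_of k)%N by apply: l_gt0.
  rewrite ltn_neqAle ek0 andbT eq_sym; apply/eqP => ek; apply: nH4.
  (* The cyclic permutation 0 -> 2, 1 -> 0, 2 -> 1, which puts the third monomial
     first. *)
  pose c : 'S_3 := perm (@addrI _ (2%:R : 'I_3)).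
  exists (fun i : 'I_3 => if i == 0 then 1%N :: rem 1%N (l (s 2%:R))
                  else if i == 1 then l' 0 else l' 1).
    exists (c * s)%g => i; rewrite permM permE.
    case: i => -[|[|[|i]]] // h /=.
    - rewrite (_ : _ + _ = 2%:R); last exact: val_inj.
      by apply: perm_to_rem; rewrite -[X in X \in _]ek -bk exponent_in.
    - by rewrite (_ : _ + _ = 0) ?sl //; apply: val_inj.
    - by rewrite (_ : _ + _ = 1) ?sl //; apply: val_inj.
  split=> /=; first by exists (rem 1%N (l (s 2%:R))).
    by rewrite l0; apply: two_evens_nseq.
  by rewrite l1; apply: two_evens_nseq.
split.
- move=> k; case: (s_cases (block_of k)) => bk; first by rewrite e0.
    by rewrite e1.
  exact: e2.
- have nonempty i v : v \in l' i -> exists k, block_of k = s i.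
    rewrite -(perm_mem (sl i)) => /in_exponent[k [bk _]].
    by exists k.
  move=> i; case: (s_cases i) => ->.
  + by apply: (nonempty 0 2); rewrite l0 inE eqxx.
  + by apply: (nonempty 1 2); rewrite l1 inE eqxx.
  + by apply: (nonempty 2%:R (head 0%N (l' 2%:R))); case: (l' 2%:R) l2 => // v r _; rewrite inE eqxx.
- right; exists (s 0), (s 1); split; first by rewrite (inj_eq perm_inj).
  by move=> k [/e0|/e1].
Qed.

End Types.

Theorem theorem4p10 (K : closedFieldType) (charK0 : [pchar K] =i pred0)
    (n : 'I_3 -> nat) (n1_gt0 : (0 < n 1%R)%N) (n2_gt0 : (0 < n 2%R)%N)
    (l : forall i, (n i).-tuple nat)
    (l_gt0 : forall i j, (0 < tnth (l i) j)%N)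
    (typeX : type_H5 (fun i => l i)
             \/ (type_H2 (fun i => l i) /\ ~ type_H4 (fun i => l i))) :
  let X := @trinomial_hypersurface K n l in
  let dimX := (\sum_i n i)%N.-1 in
  is_orbit (@Aut_alg K _ X) (@regular_point K _ dimX X) /\
  (forall O : pts X -> Prop,
     is_orbit (@Aut_alg K _ X) O ->
     (forall x, O x -> ~ regular_point dimX x) ->
     is_orbit (@torus_maps K _ (@trinomial_torus K n l) X) O).
Proof.
have [e_ge2 surj HX] := type_exponents l_gt0 typeX.
rewrite /trinomial_torus /trinomial_hypersurface trinomialE -/(hypersurface _ _).
split; first exact: regular_orbit.
by move=> O; apply: singular_orbit.
Qed.
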